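(* Let $n\ge2$, $q\in\{1,\ldots,n-1\}$ and $\gamma\in\{0,\ldots,q-1\}$. Let $L$ be a random linear subspace with distribution $\nu_q$ and let $E$ be a stochastically independent random affine subspace with distribution $\sigma_{n-q+\gamma}$, where for Borel sets $A\subseteq\{E'\in A(n,n-q+\gamma):d(o,E')=1\}$, $$\sigma_{n-q+\gamma}(A)=\frac{1}{\omega_{q-\gamma}}\int_{G(n,n-q+\gamma)}\int_{S^{n-1}\cap M^\perp}1_A(M+u)\,\mathcal{H}^{q-\gamma-1}(du)\,\nu_{n-q+\gamma}(dM).$$ Then $d(o,E\cap L)^{-2}$ has a beta distribution with shape parameters $a=\frac{\gamma+1}{2}$ and $b=\frac{n-q}{2}$. More explicitly, $$g_{n,q,\gamma}(r)=\frac{\omega_{\gamma+1}\,\omega_{n-q}}{\omega_{n-(q-\gamma)+1}}\,r^{-(\gamma+2)}\Big(1-\frac1{r^2}\Big)^{\frac{n-q}{2}-1}1_{\{r>1\}}$$ is a probability density of $d(o,E\cap L)$.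
   Context: $\omega_k=2\pi^{k/2}/\Gamma(k/2)$; $\mathcal{H}^k$ is $k$-dimensional Hausdorff measure; $S^{n-1}$ the unit sphere. $d(o,E)=\inf_{x\in E}\|x\|$. $G(n,k)$ is the Grassmannian of $k$-dimensional linear subspaces of $\mathbb{R}^n$ with $SO_n$-invariant probability measure $\nu_k$; $A(n,k)$ is the space of $k$-dimensional affine subspaces. The measure $\sigma_{n-q+\gamma}$ is the rotation invariant probability measure on affine $(n-q+\gamma)$-subspaces tangent to $S^{n-1}$. *)

(* Defs.v *)
From HB Require Import structures.
From mathcomp Require Import all_boot all_order all_algebra.
From mathcomp Require Import all_classical all_reals all_analysis.
Import numFieldNormedType.Exports.
Set Implicit Arguments. Unset Strict Implicit. Unset Printing Implicit Defensive.
Import Order.TTheory GRing.Theory Num.Theory.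
Local Open Scope classical_set_scope.
Local Open Scope ring_scope.

Section defs.
Variable R : realType.

Definition Gamma (x : R) : R :=
  Rintegral lebesgue_measure `]0, +oo[%classic (fun t => t `^ (x - 1) * expR (- t)).

Definition omega (k : nat) : R := 2 * pi `^ (k%:R / 2) / Gamma (k%:R / 2).

Definition enorm n (x : 'rV[R]_n) : R := Num.sqrt (\sum_i x 0 i ^+ 2).

Definition is_orth_proj n k (P : 'M[R]_n) : Prop :=
  P^T = P /\ P *m P = P /\ \rank P = k.

Definition rotation n (U : 'M[R]_n) : Prop := U *m U^T = 1%:M /\ \det U = 1.

Definition entry_sets n : set (set 'M[R]_n) :=
  [set A | exists i j (B : set R), measurable B /\ A = (fun M : 'M[R]_n => M i j) @^-1` B].

Definition aff_sets n : set (set ('M[R]_n * 'rV[R]_n)) :=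
  [set A | exists i j (B : set R), measurable B /\
     (A = (fun p : 'M[R]_n * 'rV[R]_n => p.1 i j) @^-1` B \/
      A = (fun p : 'M[R]_n * 'rV[R]_n => p.2 0 j) @^-1` B)].

(* Rotation action: x |-> x *m U on row vectors.  A linear subspace is coded by
   its orthogonal projection matrix P (acting on row vectors, x |-> x *m P);
   the rotated subspace has projection U^T *m P *m U. *)
Definition rotG n (U : 'M[R]_n) (P : 'M[R]_n) : 'M[R]_n := U^T *m P *m U.

(* An affine subspace of dimension k is coded by (P, u), P the orthogonal
   projection onto its direction and u the foot point (u *m P = 0), i.e. the
   flat u + range(P).  Rotation: (P, u) |-> (U^T P U, u U). *)
Definition rotA n (U : 'M[R]_n) (p : 'M[R]_n * 'rV[R]_n) : 'M[R]_n * 'rV[R]_n :=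
  (U^T *m p.1 *m U, p.2 *m U).

Definition lin_set n (P : 'M[R]_n) : set 'rV[R]_n := [set x | x *m P = x].

Definition aff_set n (p : 'M[R]_n * 'rV[R]_n) : set 'rV[R]_n :=
  [set x | (x - p.2) *m p.1 = x - p.2].

(* affine k-flats tangent to the unit sphere: d(o, E) = |u| = 1 *)
Definition tangent_flat n k (p : 'M[R]_n * 'rV[R]_n) : Prop :=
  is_orth_proj k p.1 /\ p.2 *m p.1 = 0 /\ enorm p.2 = 1.

(* d(o, S) = inf_{x in S} |x|  (= +oo for S empty) *)
Definition dist_o n (S : set 'rV[R]_n) : \bar R :=
  ereal_inf [set (enorm x)%:E | x in S].

Definition gdens (n q g : nat) (r : R) : R :=
  if 1 < r then
    omega g.+1 * omega (n - q)%N / omega (n - (q - g) + 1)%N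
    * r ^- (g + 2)%N * (1 - r ^- 2) `^ ((n - q)%N%:R / 2 - 1)
  else 0.
End defs.

Notation GrT R n := (g_sigma_algebraType (@entry_sets R n)).
Notation AffT R n := (g_sigma_algebraType (@aff_sets R n)).

(* Main.v *)
(** Only the direction [M] and the foot point [u] of the tangent flat [E = M + u] matter through
    [V = M + R u]: the flat [E /\ L] is the set of [x] in [W = L /\ V] with [<x, u> = 1], so
    [d (o, E /\ L) ^ -2] is the squared norm [a = |P_W u|^2] of the projection of [u] on [W].  By
    Fubini and the transitivity of the rotations on tangent flats, [E] may be frozen as
    [e_s + span (e_{s+1}, ...)] with [s = q - g - 1]; then [W] is [L] cut by the [s] first coordinate
    hyperplanes, and [a] is a diagonal entry of its projection matrix.

    The law of [a] follows from its moments [c_j].  By invariance under plane rotations the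
    expectation of [(x W x^T)^j] is [c_j |x|^(2j)]; comparing the coefficients of [t^2] for
    [x = e_s + t e_i] and summing over [i] gives [(N + 2j) c_{j+1} = (k + 2j) c_j], where [N = dim V]
    and [k = dim W].  The density satisfies the same recurrence after an integration by parts, and the
    moments determine a law on [0, 1] because [(1 - x^n)^(n t^-n)] tends to the indicator of [x < t].
    The beta law has no atom at [0], so each new hyperplane almost surely lowers the dimension of the
    section by one, which gives [k = q - s] by induction on [s]. *)

Require Import Defs.
From HB Require Import structures.
From mathcomp Require Import all_boot all_order all_algebra.
From mathcomp Require Import all_classical all_reals all_analysis.
From mathcomp Require Import measurable_realfun.
From mathcomp Require Import zify ring lra.
Import numFieldNormedType.Exports.
Import Order.TTheory GRing.Theory Num.Theory.
Set Implicit Arguments. Unset Strict Implicit. Unset Printing Implicit Defensive.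
Local Open Scope classical_set_scope.
Local Open Scope ring_scope.

(** Dimension and law of the sections depend on each other: the moment recurrence for a diagonal
    entry requires the current section to have almost surely constant dimension, and that constancy
    requires the previous entries to have no atom at 0. So the induction on the number of
    hyperplanes proves the dimension and calls on the law at each step. Invariance survives the cuts
    because a rotation in the plane of e_s and e_i with i > s fixes e_0, ..., e_(s-1) and therefore
    commutes with the first s cuts.

    Sections are computed on projection matrices by an explicit total formula, with z / 0 = 0 in the
    degenerate case; the distance events are then measurable in the matrix entries, empty sections
    included.

    The beta law of a is never written in its own variable. It is carried as the law of r^-2 under a
    density in r on ]1, +oo[, so that no change of variables occurs, and a factor r^(-2j) only
    replaces k by k + 2j in an integral of the same family. *)

(** * Orthogonal projections, hyperplane sections of flats and their distance to the origin *)

Definition sqn (R : realType) n (x : 'rV[R]_n) : R := \sum_i x 0 i ^+ 2.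

Lemma sqnE (R : realType) n (x : 'rV[R]_n) : x *m x^T = (sqn x)%:M.
Proof.
apply/matrixP => i j; rewrite !ord1 !mxE eqxx mulr1n.
by apply: eq_bigr => k _; rewrite mxE expr2.
Qed.

Lemma sqn_ge0 (R : realType) n (x : 'rV[R]_n) : 0 <= sqn x.
Proof. by apply: sumr_ge0 => i _; rewrite sqr_ge0. Qed.

Lemma sqn_eq0 (R : realType) n (x : 'rV[R]_n) : (sqn x == 0) = (x == 0).
Proof.
apply/eqP/eqP => [h|->]; last by apply: big1 => i _; rewrite mxE expr0n.
apply/rowP => i; rewrite mxE.
have /eqP := @psumr_eq0P _ _ xpredT (fun i => x 0 i ^+ 2) (fun i _ => sqr_ge0 _) h i isT.
by rewrite sqrf_eq0 => /eqP.
Qed.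

Lemma sqn_orth (R : realType) n m (x : 'rV[R]_n) (U : 'M[R]_(n, m)) :
  U *m U^T = 1%:M -> sqn (x *m U) = sqn x.
Proof.
move=> UU; have := sqnE (x *m U).
rewrite trmx_mul mulmxA -(mulmxA x) UU mulmx1 sqnE => /matrixP/(_ 0 0).
by rewrite !mxE eqxx !mulr1n.
Qed.

Lemma enorm_orth (R : realType) n (x : 'rV[R]_n) (U : 'M[R]_n) :
  U *m U^T = 1%:M -> enorm (x *m U) = enorm x.
Proof. by move=> /(sqn_orth x) h; rewrite /enorm -/(sqn _) h. Qed.

(* Greville's recursion for the system [x a = b]: the flat [y + range W] is cut by the
   hyperplane [x a = b]; since [z / 0 = 0] the flat is left unchanged when [W a = 0]. *)
Definition cutP (R : realType) n (W : 'M[R]_n) (a : 'cV[R]_n) : 'M[R]_n :=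
  W - (((a^T *m W *m a) 0 0)^-1) *: ((a^T *m W)^T *m (a^T *m W)).

Definition cutv (R : realType) n (W : 'M[R]_n) (y : 'rV[R]_n) (a : 'cV[R]_n) (b : R) : 'rV[R]_n :=
  y + ((b - (y *m a) 0 0) / (a^T *m W *m a) 0 0) *: (a^T *m W).

(** Orthogonal projections with the rank left free: the rank is recovered as the trace, which is
    easy to follow through a cut. *)
Definition sidem (R : realType) n (W : 'M[R]_n) := W^T = W /\ W *m W = W.

Lemma mx11B (R : realType) (A B : 'M[R]_1) : (A - B) 0 0 = A 0 0 - B 0 0.
Proof. by rewrite !mxE. Qed.

Lemma mx11Z (R : realType) c (A : 'M[R]_1) : (c *: A) 0 0 = c * A 0 0.
Proof. by rewrite !mxE. Qed.

Section cut.
Variables (R : realType) (n : nat) (W : 'M[R]_n) (a : 'cV[R]_n).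
Hypothesis sW : sidem W.

(** Since W = W W^T, the form is a squared norm, so its vanishing forces a^T W = 0; the degenerate
    cases below rest on this. *)
Lemma sidem_quad : (a^T *m W *m a) 0 0 = sqn (a^T *m W).
Proof.
case: sW => WT WW.
have := sqnE (a^T *m W); rewrite trmx_mul WT trmxK mulmxA -(mulmxA _ W W) WW.
by move=> ->; rewrite mxE eqxx mulr1n.
Qed.

Lemma cut_quad0 : (a^T *m W *m a) 0 0 = 0 -> a^T *m W = 0.
Proof. by rewrite sidem_quad => /eqP; rewrite sqn_eq0 => /eqP. Qed.

Let Ww : W *m (a^T *m W)^T = (a^T *m W)^T.
Proof. by case: sW => WT WW; rewrite trmx_mul WT mulmxA WW. Qed.

Let wW : a^T *m W *m W = a^T *m W.
Proof. by case: sW => _ WW; rewrite -mulmxA WW. Qed.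

Let aw : a^T *m (a^T *m W)^T = ((a^T *m W *m a) 0 0)%:M.
Proof.
case: sW => WT _; rewrite trmx_mul trmxK WT mulmxA.
by rewrite [LHS]mx11_scalar.
Qed.

Let ww : a^T *m W *m (a^T *m W)^T = ((a^T *m W *m a) 0 0)%:M.
Proof. by rewrite sqnE sidem_quad. Qed.

Lemma cutP_sidem : sidem (cutP W a).
Proof.
case: (sW) => WT WW; split.
  by rewrite /cutP linearB linearZ/= trmx_mul trmxK WT.
rewrite /cutP; set al := (a^T *m W *m a) 0 0; set w := a^T *m W.
have [al0|al0] := eqVneq al 0; first by rewrite al0 invr0 !scale0r !subr0.
have ww2 : (w^T *m w) *m (w^T *m w) = al *: (w^T *m w).
  by rewrite mulmxA -(mulmxA w^T w) ww mul_mx_scalar -scalemxAl.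
rewrite mulmxBl !mulmxBr WW -!scalemxAl -!scalemxAr mulmxA Ww -(mulmxA _ _ W) wW -/w ww2.
by rewrite [al^-1 *: (al *: _)]scalerA mulVf// scale1r subrr subr0.
Qed.

Lemma cutP_a : a^T *m cutP W a = 0.
Proof.
rewrite /cutP mulmxBr -scalemxAr (mulmxA a^T) aw mul_scalar_mx scalerA.
have [al0|al0] := eqVneq ((a^T *m W *m a) 0 0) 0.
  by rewrite (cut_quad0 al0) scaler0 subr0.
by rewrite mulVf// scale1r subrr.
Qed.

Lemma cutPW : cutP W a *m W = cutP W a.
Proof.
case: (sW) => WT WW; rewrite /cutP mulmxBl WW -scalemxAl.
by rewrite -(mulmxA _ _ W) wW.
Qed.

Lemma cutP_fix (x : 'rV[R]_n) : x *m cutP W a = x <-> (x *m W = x /\ (x *m a) 0 0 = 0).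
Proof.
have aW' := cutP_a; case: (cutP_sidem) => W'T W'W'; case: (sW) => WT WW.
split=> [xW'|[xW xa]].
  split; first by rewrite -xW' -mulmxA cutPW.
  have -> : x *m a = 0; last by rewrite mxE.
  rewrite -xW' -mulmxA; apply: trmx_inj; rewrite trmx_mul trmx_mul W'T aW'.
  by rewrite mul0mx trmx0.
have xw : x *m (a^T *m W)^T = x *m a by rewrite trmx_mul trmxK WT mulmxA xW.
rewrite /cutP mulmxBr xW -scalemxAr (mulmxA x) xw.
by rewrite [x *m a]mx11_scalar xa mul_scalar_mx scale0r scaler0 subr0.
Qed.

(** The correction is the projection onto the line of [a^T *m W], of trace 1, or 0 when that vector
    vanishes. *)
Lemma cutP_tr : \tr (cutP W a) = \tr W - ((a^T *m W *m a) 0 0 != 0)%:R.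
Proof.
rewrite /cutP linearB linearZ/= mxtrace_mulC ww.
rewrite mxtrace_scalar mulr1n; have [->|h] := eqVneq; first by rewrite mulr0.
by rewrite mulVf.
Qed.

Variables (y : 'rV[R]_n) (b : R).
Hypothesis yW : y *m W = 0.

Lemma cutv_perp : cutv W y a b *m cutP W a = 0.
Proof.
case: (sW) => WT WW.
have yP : y *m cutP W a = 0.
  by rewrite /cutP mulmxBr yW -scalemxAr trmx_mul trmxK WT !mulmxA yW !mul0mx scaler0 subr0.
rewrite /cutv mulmxDl yP add0r -scalemxAl -(mulmxA _ W (cutP W a)).
have -> : W *m cutP W a = cutP W a.
  by rewrite /cutP mulmxBr WW -scalemxAr (mulmxA W) Ww.
by rewrite cutP_a scaler0.
Qed.

(** If a^T W = 0, then x a is constant on the flat, so the hyperplane contains the flat or misses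
    it, and the last implication records which. Otherwise the step along a^T W is chosen to reach x
    a = b. *)
Lemma cutv_flat (x : 'rV[R]_n) :
  ((x - y) *m W = x - y /\ (x *m a) 0 0 = b) <->
  ((x - cutv W y a b) *m cutP W a = x - cutv W y a b /\
   ((a^T *m W *m a) 0 0 = 0 -> b - (y *m a) 0 0 = 0)).
Proof.
case: (sW) => WT WW; rewrite /cutv.
set al := (a^T *m W *m a) 0 0; set w := a^T *m W; pose c := (b - (y *m a) 0 0) / al.
rewrite -/c cutP_fix opprD addrA.
have -> : (x - y - c *: w) *m W = (x - y) *m W - c *: w.
  by rewrite mulmxBl -scalemxAl wW.
have -> : ((x - y - c *: w) *m a) 0 0 = (x *m a) 0 0 - (y *m a) 0 0 - c * al.
  by rewrite mulmxBl -scalemxAl mulmxBl !mx11B mx11Z.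
split=> [[h1 h2]|[[h1 h2] h3]].
  have al0 : al = 0 -> b - (y *m a) 0 0 = 0.
    move=> /cut_quad0 w0; rewrite -h2.
    have -> : (x *m a) 0 0 - (y *m a) 0 0 = ((x - y) *m a) 0 0 by rewrite mulmxBl mx11B.
    have -> : (x - y) *m a = (x - y) *m (a^T *m W)^T by rewrite trmx_mul WT trmxK mulmxA h1.
    by rewrite w0 trmx0 mulmx0 mxE.
  split; last by [].
  split; first by rewrite h1.
  have [al00|al00] := eqVneq al 0.
    by rewrite al00 mulr0 subr0 h2 al0.
  by rewrite /c h2 divfK// subrr.
split; first by apply: (addIr (- (c *: w))).
move: h2 h3; rewrite /c; have [-> h2 h3|al00 h2 _] := eqVneq al 0.
  by move: h2 (h3 erefl); rewrite mulr0; lra.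
by move: h2; rewrite divfK//; lra.
Qed.

End cut.

(** [y] is orthogonal to the direction of the flat, so Pythagoras applies to x = y + (x - y). *)
Lemma flat_min_norm (R : realType) n (W : 'M[R]_n) (y x : 'rV[R]_n) :
  W^T = W -> y *m W = 0 -> (x - y) *m W = x - y -> enorm y <= enorm x.
Proof.
move=> WT yW xW; rewrite ler_wsqrtr//.
have -> : x = y + (x - y) by rewrite addrC subrK.
set z := x - y in xW *; rewrite -/(sqn _) -/(sqn _).
have yz : y *m z^T = 0 by rewrite -xW trmx_mul WT mulmxA yW mul0mx.
have := sqnE (y + z); rewrite linearD/= mulmxDl !mulmxDr yz !sqnE addr0.
have -> : z *m y^T = 0 by apply: trmx_inj; rewrite trmx_mul trmxK yz trmx0.
rewrite add0r => /matrixP/(_ 0 0); rewrite !mxE eqxx !mulr1n => <-.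
by rewrite lerDl sqn_ge0.
Qed.

Lemma dist_flat (R : realType) n (W : 'M[R]_n) (y : 'rV[R]_n) :
  W^T = W -> y *m W = 0 ->
  dist_o [set x | (x - y) *m W = x - y] = (enorm y)%:E.
Proof.
move=> WT yW; apply/eqP; rewrite eq_le; apply/andP; split.
  by apply: ereal_inf_lbound; exists y => //=; rewrite subrr mul0mx.
apply: le_ereal_inf_tmp => _ [x /= xW <-]; rewrite lee_fin.
exact: flat_min_norm xW.
Qed.

Lemma dist_set0 (R : realType) n : @dist_o R n set0 = +oo%E.
Proof. by rewrite /dist_o image_set0 ereal_inf0. Qed.

(** In a rank factorisation P = C R, idempotence says C (R C) R = C R; cancelling C and R leaves R C
    = 1, of size the rank, and tr (C R) = tr (R C). *)
Lemma mxtrace_idem (R : realType) n (P : 'M[R]_n) : P *m P = P -> \tr P = (\rank P)%:R.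
Proof.
move=> PP; have CR := mulmx_base P.
have : row_base P *m col_base P = 1%:M.
  have : col_base P *m (row_base P *m col_base P) *m row_base P = col_base P *m 1%:M *m row_base P.
    by rewrite mulmx1 CR mulmxA CR -mulmxA CR PP.
  move/(row_free_inj (row_base_free P)) => h.
  have [D DC] : exists D, D *m col_base P = 1%:M.
    by have /row_fullP := col_base_full P.
  by have := congr1 (mulmx D) h; rewrite mulmxA DC mul1mx mulmx1 DC.
by move=> RC; rewrite -{1}CR mxtrace_mulC RC mxtrace1.
Qed.

(** A projection of positive trace has a nonzero diagonal entry; the normalised row e_i P is a unit
    vector of the range, and [cutP] removes exactly this direction, which lowers the trace by
    one. *)
Lemma frame_exists (R : realType) n r (P : 'M[R]_n) : sidem P -> \tr P = r%:R ->
  exists F : 'M[R]_(r, n), F *m F^T = 1%:M /\ F^T *m F = P.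
Proof.
elim: r P => [|r IH] P sP trP.
  exists 0; split; first by apply/matrixP => -[].
  case: (sP) => PT PP; rewrite mulmx0; apply/esym/eqP; rewrite -mxrank_eq0.
  by have := mxtrace_idem PP; rewrite trP => /eqP; rewrite eqr_nat eq_sym.
have [i Pi0] : exists i, P i i != 0.
  apply/existsP; apply: contraT; rewrite negb_exists => /forallP h.
  have : \tr P = 0 by apply: big1 => i _; apply/eqP; rewrite -[_ == _]negbK h.
  by rewrite trP => /eqP; rewrite pnatr_eq0.
pose a : 'cV[R]_n := delta_mx i 0.
have E : (a^T *m P *m a) 0 0 = P i i.
  by rewrite trmx_delta -rowE -colE !mxE.
pose al := P i i; pose w : 'rV[R]_n := (Num.sqrt al)^-1 *: (a^T *m P).
have al0 : 0 < al.
  by rewrite lt_def Pi0 /= /al -E sidem_quad// sqn_ge0.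
have [|F [F1 F2]] := IH _ (cutP_sidem a sP).
  by rewrite cutP_tr// E Pi0 trP -natr1 addrK.
have aF : w *m F^T = 0.
  have : cutP P a *m F^T = F^T by rewrite -F2 -mulmxA F1 mulmx1.
  move=> <-; rewrite /w -scalemxAl !mulmxA -(mulmxA _ P).
  case: (sP) => PT PP; have -> : P *m cutP P a = cutP P a.
    apply: trmx_inj; rewrite trmx_mul; case: (cutP_sidem a sP) => -> _.
    by rewrite PT cutPW.
  by rewrite cutP_a// mul0mx scaler0.
have wwT : w *m w^T = 1%:M.
  rewrite sqnE /w.
  have -> : sqn ((Num.sqrt al)^-1 *: (a^T *m P)) = al^-1 * sqn (a^T *m P).
    rewrite /sqn mulr_sumr; apply: eq_bigr => j _.
    by rewrite mxE exprMn exprVn sqr_sqrtr// ltW.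
  by rewrite -sidem_quad// E mulVf.
suff : exists F : 'M[R]_(1 + r, n), F *m F^T = 1%:M /\ F^T *m F = P by [].
exists (col_mx w F); split.
  rewrite tr_col_mx mul_col_row wwT aF F1.
  have -> : F *m w^T = 0 by apply: trmx_inj; rewrite trmx_mul trmxK aF trmx0.
  by rewrite -scalar_mx_block.
rewrite tr_col_mx mul_row_col F2 /cutP E.
have -> : w^T = (Num.sqrt al)^-1 *: (a^T *m P)^T by rewrite linearZ.
rewrite /w -scalemxAl -scalemxAr scalerA -invfM -expr2 sqr_sqrtr ?ltW//.
by rewrite addrC subrK.
Qed.

(** * Measurability *)

Lemma In_mem (T : eqType) (x : T) (s : seq T) : x \in s -> List.In x s.
Proof.
by elim: s => // y s IH; rewrite inE => /orP[/eqP ->|/IH]; [left|right].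
Qed.

Section entries.
Context d (T : measurableType d) (R : realType).

Definition mxmeas m n (A : T -> 'M[R]_(m, n)) := forall i j, measurable_fun setT (fun x => A x i j).

Lemma mxmeas_cst m n (A : 'M[R]_(m, n)) : mxmeas (fun=> A).
Proof. by move=> i j; exact: measurable_cst. Qed.

Lemma mxmeas_mul m n p (A : T -> 'M[R]_(m, n)) (B : T -> 'M[R]_(n, p)) :
  mxmeas A -> mxmeas B -> mxmeas (fun x => A x *m B x).
Proof.
move=> mA mB i j; under eq_fun do rewrite mxE.
by apply: measurable_sum => k; exact: measurable_funM.
Qed.

Lemma mxmeas_tr m n (A : T -> 'M[R]_(m, n)) : mxmeas A -> mxmeas (fun x => (A x)^T).
Proof. by move=> mA i j; under eq_fun do rewrite mxE; exact: mA. Qed.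

Lemma mxmeas_add m n (A B : T -> 'M[R]_(m, n)) :
  mxmeas A -> mxmeas B -> mxmeas (fun x => A x + B x).
Proof. by move=> mA mB i j; under eq_fun do rewrite mxE; exact: measurable_funD. Qed.

Lemma mxmeas_sub m n (A B : T -> 'M[R]_(m, n)) :
  mxmeas A -> mxmeas B -> mxmeas (fun x => A x - B x).
Proof. by move=> mA mB i j; under eq_fun do rewrite 2!mxE; exact: measurable_funB. Qed.

Lemma mxmeas_scale m n (c : T -> R) (A : T -> 'M[R]_(m, n)) :
  measurable_fun setT c -> mxmeas A -> mxmeas (fun x => c x *: A x).
Proof. by move=> mc mA i j; under eq_fun do rewrite mxE; exact: measurable_funM. Qed.

Lemma mxmeas_col m n (A : T -> 'M[R]_(m, n)) (j : 'I_n) : mxmeas A -> mxmeas (fun x => col j (A x)).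
Proof. by move=> mA i k; under eq_fun do rewrite mxE; exact: mA. Qed.

Lemma measurable_fun_inv (c : T -> R) : measurable_fun setT c -> measurable_fun setT (fun x => (c x)^-1).
Proof.
move=> mc.
(* The real power is known to be measurable; at c = 0 both sides are 0. *)
have -> : (fun x => (c x)^-1) = (fun x => c x * (c x ^+ 2) `^ (-1)).
  apply/funext => x; rewrite powR_inv1 ?sqr_ge0//.
  have [->|c0] := eqVneq (c x) 0; first by rewrite invr0 mul0r.
  by rewrite expr2 invfM mulrA divff// mul1r.
apply: measurable_funM => //.
by apply: (measurableT_comp (measurable_powR _)); exact: measurable_funX.
Qed.

Lemma measurable_eq0 (f : T -> R) : measurable_fun setT f -> measurable [set x | f x = 0].
Proof.
move=> mf; have := mf measurableT [set 0] (measurable_set1 0).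
by rewrite setTI; congr measurable; apply/seteqP; split => x.
Qed.

Lemma measurable_mx_eq m n (A B : T -> 'M[R]_(m, n)) :
  mxmeas A -> mxmeas B -> measurable [set x | A x = B x].
Proof.
move=> mA mB.
have -> : [set x | A x = B x] = \bigcap_(i in [set: 'I_m]) \bigcap_(j in [set: 'I_n]) [set x | A x i j - B x i j = 0].
  apply/seteqP; split => [x /= h i _ j _ /=|x h]; first by rewrite h subrr.
  by apply/matrixP => i j; apply/eqP; rewrite -subr_eq0; apply/eqP; exact: h.
apply: fin_bigcap_measurable => // i _; apply: fin_bigcap_measurable => // j _.
by apply: measurable_eq0; exact: measurable_funB.
Qed.

Lemma measurable_enorm n (x : T -> 'rV[R]_n) : mxmeas x -> measurable_fun setT (fun t => enorm (x t)).
Proof.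
move=> mx; apply: (measurableT_comp (continuous_measurable_fun (@sqrt_continuous R))).
by apply: measurable_sum => i; exact: measurable_funX.
Qed.

Lemma mxmeas_cutP n (W : T -> 'M[R]_n) (a : T -> 'cV[R]_n) :
  mxmeas W -> mxmeas a -> mxmeas (fun x => cutP (W x) (a x)).
Proof.
move=> mW ma; have mw := mxmeas_mul (mxmeas_tr ma) mW.
apply: mxmeas_sub => //; apply: mxmeas_scale.
  by apply: measurable_fun_inv; exact: (mxmeas_mul mw ma).
by apply: mxmeas_mul => //; exact: mxmeas_tr.
Qed.

Lemma mxmeas_cutv n (W : T -> 'M[R]_n) (y : T -> 'rV[R]_n) (a : T -> 'cV[R]_n) (b : T -> R) :
  mxmeas W -> mxmeas y -> mxmeas a -> measurable_fun setT b ->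
  mxmeas (fun x => cutv (W x) (y x) (a x) (b x)).
Proof.
move=> mW my ma mb; have mw := mxmeas_mul (mxmeas_tr ma) mW.
apply: mxmeas_add => //; apply: mxmeas_scale => //.
apply: measurable_funM.
  by apply: measurable_funB => //; exact: (mxmeas_mul my ma).
by apply: measurable_fun_inv; exact: (mxmeas_mul mw ma).
Qed.

(* A triple [(W, y, e)] codes the flat [y + range W] if [e = 0] and the empty set otherwise. *)
Lemma affine_system_code n (s : seq ((T -> 'cV[R]_n) * (T -> R))) :
  (forall ab, List.In ab s -> mxmeas ab.1 /\ measurable_fun setT ab.2) ->
  exists (W : T -> 'M[R]_n) (y : T -> 'rV[R]_n) (e : T -> R),
    [/\ mxmeas W, mxmeas y, measurable_fun setT e &
    forall t, sidem (W t) /\ y t *m W t = 0 /\ 0 <= e t /\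
     forall x : 'rV[R]_n, (forall ab, List.In ab s -> (x *m ab.1 t) 0 0 = ab.2 t) <->
       (e t = 0 /\ (x - y t) *m W t = x - y t)].
Proof.
elim: s => [_|[a b] s IH mab].
  exists (fun=> 1%:M), (fun=> 0), (fun=> 0); split; do ?exact: mxmeas_cst.
    exact: measurable_cst.
  move=> t; split; first by split; rewrite ?trmx1 ?mulmx1.
  by split; [rewrite mulmx1|split=> // x; split=> // _; rewrite subr0 mulmx1].
have [|W [y [e [mW my me H]]]] := IH; first by move=> ab h; apply: mab; right.
have [/= ma mb] := mab (a, b) (or_introl erefl).
pose al t := ((a t)^T *m W t *m a t) 0 0.
have mal : measurable_fun setT al by exact: (mxmeas_mul (mxmeas_mul (mxmeas_tr ma) mW) ma).
pose rho t := b t - (y t *m a t) 0 0.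
have mrho : measurable_fun setT rho by apply: measurable_funB => //; exact: (mxmeas_mul my ma).
exists (fun t => cutP (W t) (a t)), (fun t => cutv (W t) (y t) (a t) (b t)),
  (fun t => e t + (al t == 0)%:R * rho t ^+ 2); split.
- exact: mxmeas_cutP.
- exact: mxmeas_cutv.
- apply: measurable_funD => //; apply: measurable_funM; last exact: measurable_funX.
  apply: (measurableT_comp (f := fun c : bool => c%:R : R)) => //.
  by apply: measurable_fun_eqr => //; exact: measurable_cst.
move=> t; have [sW [yW [e0 Hx]]] := H t.
split; first exact: cutP_sidem.
split; first exact: cutv_perp.
have r0 : 0 <= (al t == 0)%:R * rho t ^+ 2 by rewrite mulr_ge0// sqr_ge0.
split; first by rewrite addr_ge0.
have E : e t + (al t == 0)%:R * rho t ^+ 2 = 0 <-> e t = 0 /\ (al t = 0 -> rho t = 0).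
  split=> [/eqP|[-> h]].
    rewrite paddr_eq0// => /andP[/eqP -> h]; split=> // al0.
    by move: h; rewrite al0 eqxx mul1r sqrf_eq0 => /eqP.
  rewrite add0r; have [/h ->|_] := eqVneq (al t) 0; last by rewrite mul0r.
  by rewrite expr0n mulr0.
move=> x; rewrite E; split=> [h|[[h1 h2] h3]].
  have [|h1 h2] := (Hx x).1 _; first by move=> ab hab; apply: h; right.
  have h3 : (x *m a t) 0 0 = b t by exact: (h (a, b) (or_introl erefl)).
  by have [h4 h5] := (@cutv_flat _ _ _ (a t) sW (y t) (b t) x).1 (conj h2 h3).
have [h4 h5] := (@cutv_flat _ _ _ (a t) sW (y t) (b t) x).2 (conj h3 h2).
move=> ab [<-//|]; apply: (Hx x).2; by split.
Qed.

(** The system is imposed one column at a time. If it is consistent, the distance is the norm of the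
    foot point [y]; otherwise it is +oo, which is outside the image of [B]. *)
Lemma measurable_dist_affine n k (A : T -> 'M[R]_(n, k)) (b : T -> 'rV[R]_k) (B : set R) :
  mxmeas A -> mxmeas b -> measurable B ->
  measurable [set t | (EFin @` B) (dist_o [set x : 'rV[R]_n | x *m A t = b t])].
Proof.
move=> mA mb mB.
pose s := [seq (fun t => col j (A t), fun t => b t 0 j) | j <- enum 'I_k].
have [|W [y [e [mW my me H]]]] := @affine_system_code n s.
  move=> ab /List.in_map_iff[j [<- _]]; split; first exact: mxmeas_col.
  exact: mb.
have solE t x : x *m A t = b t <-> (e t = 0 /\ (x - y t) *m W t = x - y t).
  have [_ [_ [_ Hx]]] := H t; rewrite -Hx; split=> [xA ab /List.in_map_iff[j [<- _]] /=|h].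
    by rewrite -xA !mxE; apply: eq_bigr => i _; rewrite !mxE.
  apply/rowP => j; have := h (fun t => col j (A t), fun t => b t 0 j).
  move=> /(_ _)/wrap[]; last first.
    by move=> /= <-; rewrite !mxE; apply: eq_bigr => i _; rewrite !mxE.
  apply/List.in_map_iff; exists j; split=> //.
  by apply: In_mem; rewrite mem_enum.
have -> : [set t | (EFin @` B) (dist_o [set x : 'rV[R]_n | x *m A t = b t])] =
    [set t | e t = 0] `&` (fun t => enorm (y t)) @^-1` B.
  apply/seteqP; split => t /=.
  - have [e0|e0] := pselect (e t = 0).
      have -> : [set x : 'rV[R]_n | x *m A t = b t] = [set x | (x - y t) *m W t = x - y t].
        by apply/seteqP; split => x /= => [/solE[]//|h]; apply/solE.
      have [[WT _] [yW _]] := H t; rewrite dist_flat//.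
      by move=> [r Br [<-]].
    have -> : [set x : 'rV[R]_n | x *m A t = b t] = set0.
      by apply/seteqP; split => x //= /solE[].
    by rewrite dist_set0 => -[].
  - move=> [e0 By]; exists (enorm (y t)) => //.
    have -> : [set x : 'rV[R]_n | x *m A t = b t] = [set x | (x - y t) *m W t = x - y t].
      by apply/seteqP; split => x /= => [/solE[]//|h]; apply/solE.
    by have [[WT _] [yW _]] := H t; rewrite dist_flat.
apply: measurableI; first exact: measurable_eq0.
by rewrite -[X in measurable X]setTI; apply: measurable_enorm.
Qed.

End entries.

Lemma mxmeas_GrT (R : realType) n : mxmeas (fun P : GrT R n => (P : 'M[R]_n)).
Proof.
move=> i j _ B mB; rewrite setTI; apply: sub_gen_smallest.
by exists i, j, B.
Qed.

Lemma mxmeas_AffT1 (R : realType) n : mxmeas (fun p : AffT R n => (p.1 : 'M[R]_n)).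
Proof.
move=> i j _ B mB; rewrite setTI; apply: sub_gen_smallest.
by exists i, j, B; split=> //; left.
Qed.

Lemma mxmeas_AffT2 (R : realType) n : (0 < n)%N -> mxmeas (fun p : AffT R n => (p.2 : 'rV[R]_n)).
Proof.
move=> n0 i j _ B mB; rewrite setTI; apply: sub_gen_smallest.
(* The generators of [aff_sets] carry a row index also for the foot point; any index serves. *)
exists (Ordinal n0), j, B; split=> //; right.
by apply/seteqP; split => p /=; rewrite ord1.
Qed.

Lemma measurable_rotG (R : realType) n (U : 'M[R]_n) :
  measurable_fun [set: GrT R n] (rotG U : GrT R n -> GrT R n).
Proof.
suff : measurable_fun [set: GrT R n] (rotG U : GrT R n -> GrT R n) by [].
have mU : mxmeas (fun P : GrT R n => U^T *m (P : 'M[R]_n) *m U).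
  apply: mxmeas_mul; last exact: mxmeas_cst.
  by apply: mxmeas_mul; [exact: mxmeas_cst|exact: mxmeas_GrT].
have H := @measurability _ _ (GrT R n) (GrT R n) setT (rotG U) (@entry_sets R n) erefl.
apply: H => _ [_ [i [j [B [mB ->]]]] <-].
by have := mU i j measurableT B mB.
Qed.

Lemma sidem_orth_proj (R : realType) n k (P : 'M[R]_n) :
  is_orth_proj k P <-> sidem P /\ \tr P = k%:R.
Proof.
split=> [[PT [PP rP]]|[[PT PP] tP]]; first by rewrite mxtrace_idem// rP.
split=> //; split=> //; apply/eqP; rewrite -(eqr_nat R) -mxtrace_idem//.
exact/eqP.
Qed.

Lemma measurable_trace d (T : measurableType d) (R : realType) n (A : T -> 'M[R]_n) :
  mxmeas A -> measurable_fun setT (fun x => \tr (A x)).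
Proof. by move=> mA; apply: measurable_sum => i; exact: mA. Qed.

Lemma measurable_orth_proj d (T : measurableType d) (R : realType) n k (A : T -> 'M[R]_n) :
  mxmeas A -> measurable [set x | is_orth_proj k (A x)].
Proof.
move=> mA.
have -> : [set x | is_orth_proj k (A x)] =
  [set x | (A x)^T = A x] `&` [set x | A x *m A x = A x] `&` [set x | \tr (A x) - k%:R = 0].
  apply/seteqP; split => x /=.
    by move=> /sidem_orth_proj[[PT PP] ->]; rewrite subrr.
  move=> [[PT PP] /eqP]; rewrite subr_eq0 => /eqP tP.
  by apply/sidem_orth_proj.
apply: measurableI; first apply: measurableI.
- by apply: measurable_mx_eq => //; exact: mxmeas_tr.
- by apply: measurable_mx_eq => //; exact: mxmeas_mul.
- by apply: measurable_eq0; apply: measurable_funB; [exact: measurable_trace|exact: measurable_cst].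
Qed.

Lemma measurable_tangent_flat (R : realType) n k : (0 < n)%N ->
  measurable [set p : AffT R n | tangent_flat k p].
Proof.
move=> n0; have m1 := @mxmeas_AffT1 R n; have m2 := @mxmeas_AffT2 R n n0.
have -> : [set p : AffT R n | tangent_flat k p] =
  [set p : AffT R n | is_orth_proj k p.1] `&` [set p : AffT R n | p.2 *m p.1 = 0]
   `&` [set p : AffT R n | enorm p.2 - 1 = 0].
  apply/seteqP; split => p /=; first by move=> [h1 [h2 ->]]; rewrite subrr.
  by move=> [[h1 h2] /eqP]; rewrite subr_eq0 => /eqP h3.
apply: measurableI; first apply: measurableI.
- exact: measurable_orth_proj.
- by apply: measurable_mx_eq; [exact: mxmeas_mul|exact: mxmeas_cst].
- by apply: measurable_eq0; apply: measurable_funB; [exact: measurable_enorm|exact: measurable_cst].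
Qed.

Lemma measurable_dist_event (R : realType) n (B : set R) : (0 < n)%N -> measurable B ->
  measurable [set LE : GrT R n * AffT R n |
    (EFin @` B) (dist_o (lin_set LE.1 `&` aff_set LE.2))].
Proof.
move=> n0 mB.
(* x lies in L iff x (P - 1) = 0, and in E iff (x - u) (Q - 1) = 0: together a single linear system
   with measurable coefficients. *)
pose A (z : GrT R n * AffT R n) : 'M[R]_(n, n + n) :=
  row_mx ((z.1 : 'M[R]_n) - 1%:M) ((z.2 : 'M[R]_n * 'rV[R]_n).1 - 1%:M).
pose b (z : GrT R n * AffT R n) : 'rV[R]_(n + n) :=
  row_mx 0 ((z.2 : 'M[R]_n * 'rV[R]_n).2 *m ((z.2 : 'M[R]_n * 'rV[R]_n).1 - 1%:M)).
have E z : lin_set z.1 `&` aff_set z.2 = [set x | x *m A z = b z].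
  apply/seteqP; split => x /=; rewrite /A /b /lin_set /aff_set /=.
    move=> [h1 h2]; rewrite mul_mx_row; congr row_mx.
      by rewrite mulmxBr h1 mulmx1 subrr.
    apply/eqP; rewrite -subr_eq0 -mulmxBl mulmxBr h2 mulmx1 subrr//.
  rewrite mul_mx_row => /eq_row_mx[h1 h2]; split.
    by apply/eqP; rewrite -subr_eq0 -[X in _ - X]mulmx1 -mulmxBr h1.
  have E1 : forall y : 'rV[R]_n, y *m z.2.1 - y = y *m (z.2.1 - 1%:M) by move=> y; rewrite mulmxBr mulmx1.
  by apply/eqP; rewrite -subr_eq0 E1 mulmxBl h2 subrr.
under eq_set do rewrite E.
have mP : mxmeas (fun z : GrT R n * AffT R n => (z.1 : 'M[R]_n)).
  by move=> i j; exact: (measurableT_comp (@mxmeas_GrT R n i j) measurable_fst).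
have mQ : mxmeas (fun z : GrT R n * AffT R n => ((z.2 : 'M[R]_n * 'rV[R]_n).1 : 'M[R]_n)).
  by move=> i j; exact: (measurableT_comp (@mxmeas_AffT1 R n i j) measurable_snd).
have mu' : mxmeas (fun z : GrT R n * AffT R n => ((z.2 : 'M[R]_n * 'rV[R]_n).2 : 'rV[R]_n)).
  by move=> i j; exact: (measurableT_comp (@mxmeas_AffT2 R n n0 i j) measurable_snd).
have m1 : mxmeas (fun _ : GrT R n * AffT R n => (1%:M : 'M[R]_n)) by exact: mxmeas_cst.
apply: measurable_dist_affine => // i j; rewrite /A /b.
  case: (split_ordP j) => k ->.
    by under eq_fun do rewrite row_mxEl; exact: (mxmeas_sub mP m1).
  by under eq_fun do rewrite row_mxEr; exact: (mxmeas_sub mQ m1).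
case: (split_ordP j) => k ->.
  by under eq_fun do rewrite row_mxEl; exact: mxmeas_cst.
by under eq_fun do rewrite row_mxEr; exact: (mxmeas_mul mu' (mxmeas_sub mQ m1)).
Qed.

(** * The radial density *)

(** Keeping [f1] and [f2] on opposite sides makes the identity meaningful even when both integrals
    are infinite. It holds on compact intervals, and monotone convergence passes it to the limit. *)
Lemma FTC2_open_ray (R : realType) (f1 f2 F : R -> R) (a la ly : R) :
  (forall x, a < x -> is_derive x 1 F (f2 x - f1 x)) ->
  (forall x, a < x -> {for x, continuous f1}) ->
  (forall x, a < x -> {for x, continuous f2}) ->
  (forall x, a < x -> 0 <= f1 x) -> (forall x, a < x -> 0 <= f2 x) ->
  F x @[x --> a^'+] --> la -> F x @[x --> +oo] --> ly ->
  (\int[lebesgue_measure]_(x in `]a, +oo[) (f2 x)%:E =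
   \int[lebesgue_measure]_(x in `]a, +oo[) (f1 x)%:E + (ly - la)%:E)%E.
Proof.
move=> dF c1 c2 p1 p2 Fa Fy.
(* The shift by two gives 1 / (n + 2) < 1 <= n + 1, so that [l n < u n] already for n = 0. *)
pose l n : R := a + (n.+2%:R)^-1.
pose u n : R := a + n.+1%:R.
pose I n : set R := `[l n, u n]%classic.
have al n : a < l n by rewrite /l ltrDl invr_gt0 ltr0n.
have lu n : l n < u n.
  rewrite /l /u ltrD2l (@lt_le_trans _ _ 1)//; last by rewrite ler1n.
  by rewrite invf_lt1 ?ltr0n// ltr1n.
have nd : nondecreasing_seq I.
  move=> m n mn; apply/subsetPset => x; rewrite /I /= !in_itv/= => /andP[h1 h2].
  apply/andP; split; first (apply: le_trans h1; rewrite /l lerD2l lef_pV2 ?posrE ?ltr0n//).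
    by rewrite ler_nat !ltnS.
  by apply: (le_trans h2); rewrite /u lerD2l ler_nat ltnS.
have UI : \bigcup_n I n = `]a, +oo[%classic.
  apply/seteqP; split => x /=.
    by case=> n _; rewrite /I /= !in_itv/= andbT => /andP[h _]; apply: lt_le_trans h.
  rewrite in_itv/= andbT => ax.
  have xa : 0 < x - a by rewrite subr_gt0.
  pose n := (Num.truncn (x - a) + Num.truncn ((x - a)^-1))%N.
  exists n => //; rewrite /I /= in_itv/= /l /u.
  have h1 : (n.+2%:R)^-1 <= x - a.
    rewrite invf_ple ?posrE ?ltr0n//; apply: ltW.
    apply: (lt_le_trans (truncnS_gt _)); rewrite ler_nat /n.
    by rewrite ltnS; apply: (leq_trans (leq_addl _ _)).
  have h2 : x - a <= n.+1%:R.
    apply: ltW; apply: (lt_le_trans (truncnS_gt _)); rewrite ler_nat /n.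
    by rewrite ltnS leq_addr.
  by apply/andP; split; [rewrite -lerBrDl|rewrite -lerBlDl].
have sub n x : I n x -> a < x.
  by rewrite /I /= in_itv/= => /andP[h _]; apply: lt_le_trans h.
have wc (f : R -> R) n : (forall x, a < x -> {for x, continuous f}) ->
    {within I n, continuous f}.
  move=> cf; apply/continuous_within_itvP; first exact: lu.
  have := al n; have := lu n => h1 h2; split.
  - move=> x; rewrite in_itv/= => /andP[xl _]; apply: cf; exact: lt_trans xl.
  - by apply: cvg_at_right_filter; apply: cf.
  - by apply: cvg_at_left_filter; apply: cf; apply: lt_trans h1.
have mE (f : R -> R) n : (forall x, a < x -> {for x, continuous f}) ->
    measurable_fun (I n) f.
  move=> cf; apply: measurable_realfun.subspace_continuous_measurable_fun => //.
    exact: measurable_itv.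
  exact: wc.
have intI (f : R -> R) n : (forall x, a < x -> {for x, continuous f}) ->
    lebesgue_measure.-integrable (I n) (EFin \o f).
  move=> cf; apply: continuous_compact_integrable; last exact: wc.
  exact: segment_compact.
have cv (f : R -> R) : (forall x, a < x -> {for x, continuous f}) ->
    (forall x, a < x -> 0 <= f x) ->
    (\int[lebesgue_measure]_(x in I n) (f x)%:E)%E @[n --> \oo] -->
    (\int[lebesgue_measure]_(x in `]a, +oo[) (f x)%:E)%E.
  move=> cf pf; rewrite -UI; apply: ge0_nondecreasing_set_cvg_integral => //.
  - by move=> n; exact: measurable_itv.
  - by move=> n; apply/measurable_EFinP; apply: mE.
  - by move=> n x /sub ax; rewrite lee_fin; apply: pf.
have cF x : a < x -> {for x, continuous F}.
  move=> ax; apply: differentiable_continuous; apply/derivable1_diffP.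
  by have [] := dF _ ax.
have key n : (\int[lebesgue_measure]_(x in I n) (f2 x)%:E =
   \int[lebesgue_measure]_(x in I n) (f1 x)%:E + (F (u n) - F (l n))%:E)%E.
  have := @continuous_FTC2 R (fun x => f2 x - f1 x) F (l n) (u n) (lu n).
  move=> /(_ _ _ _)/wrap[].
  - apply: (wc (fun x => f2 x - f1 x)) => x ax; apply: continuousB; [exact: c2|exact: c1].
  - split.
    + move=> x; rewrite in_itv/= => /andP[h _].
      by have [] := dF _ (lt_trans (al n) h).
    + by apply: cvg_at_right_filter; apply: cF.
    + by apply: cvg_at_left_filter; apply: cF; apply: lt_trans (lu n).
  - move=> x; rewrite in_itv/= => /andP[h _].
    by rewrite derive1E; have /@derive_val := dF _ (lt_trans (al n) h).
  rewrite -/(I n) => E.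
  rewrite EFinB -E -integralD_EFin//; [|exact: measurable_itv|exact: intI|].
    by apply: eq_integral => x _; rewrite -EFinD addrC subrK.
  by apply: (intI (fun x => f2 x - f1 x)) => x ax; apply: continuousB; [exact: c2|exact: c1].
have c2' := cv _ c2 p2; have c1' := cv _ c1 p1.
have cF' : (F (u n) - F (l n))%:E @[n --> \oo] --> (ly - la)%:E.
  apply: cvg_EFin; first exact: nearW.
  apply: cvgB.
    apply: (cvg_comp _ _ _ Fy); rewrite /u.
    apply/cvgryPge => M; near=> n.
    rewrite -lerBlDl (@le_trans _ _ n%:R)//; last by rewrite ler_nat.
    near: n; exact: nbhs_infty_ger.
  move/cvg_at_rightP : Fa; apply; split=> [n|]; first exact: al.
  rewrite /l -[X in _ --> X]addr0; apply: cvgD; first exact: cvg_cst.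
  by have := @cvg_harmonic R; rewrite -cvg_shiftS.
have c3 : (\int[lebesgue_measure]_(x in I n) (f1 x)%:E + (F (u n) - F (l n))%:E)%E @[n --> \oo] -->
   (\int[lebesgue_measure]_(x in `]a, +oo[) (f1 x)%:E + (ly - la)%:E)%E.
  by apply: cvgeD => //; apply: fin_num_adde_defl.
have E := funext key; rewrite -E in c3.
exact: (cvg_unique _ c2' c3).
Unshelve. all: by end_near. Qed.

Section radial.
Variable R : realType.
Implicit Types (a k d : nat) (e r : R).

Definition phi a e r : R := r^-1 ^+ a * (1 - r^-1 ^+ 2) `^ e.

Lemma radial_base_gt0 r : 1 < r -> 0 < 1 - r^-1 ^+ 2.
Proof.
move=> r1; have r0 : 0 < r by apply: lt_trans r1.
by rewrite subr_gt0 expr_lt1// ?invr_ge0 ?ltW// invf_lt1.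
Qed.

Lemma phi_ge0 a e r : 1 < r -> 0 <= phi a e r.
Proof.
move=> r1; have r0 : 0 < r by apply: lt_trans r1.
by rewrite mulr_ge0// ?powR_ge0// exprn_ge0// invr_ge0 ltW.
Qed.

Lemma is_derive_inv r : r != 0 -> is_derive r 1 (fun x : R => x^-1) (- r^-1 ^+ 2).
Proof.
move=> r0; have := @is_deriveV R id r 1 1 r0 (@is_derive_id _ _ _ _).
by rewrite exprVn => h; apply: is_derive_eq h _; rewrite /GRing.scale/= mulr1.
Qed.

Lemma is_derive_ext (f g : R -> R) r (u v : R) :
  f =1 g -> u = v -> is_derive r 1 f u -> is_derive r 1 g v.
Proof. by move=> /funext <- <-. Qed.

Lemma is_derive_near_ext (f g : R -> R) r (u : R) :
  {near r, f =1 g} -> is_derive r 1 f u -> is_derive r 1 g u.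
Proof.
move=> fg [df <-]; split; first exact: near_eq_derivable df.
by apply/esym; exact: near_eq_derive.
Qed.

Lemma is_derive_phi a e r : 1 < r ->
  is_derive r 1 (phi a e) (2 * e * phi (a + 3) (e - 1) r - a%:R * phi a.+1 e r).
Proof.
move=> r1; have r0 : 0 < r by apply: lt_trans r1.
have rn0 : r != 0 by rewrite gt_eqF.
have w0 := radial_base_gt0 r1.
pose h (x : R) := x^-1.
have dh := is_derive_inv rn0.
have d1 : is_derive r 1 (h ^+ a) (a%:R * r^-1 ^+ a.-1 * (- r^-1 ^+ 2)).
  by have := @is_deriveX R _ h a r 1 _ dh.
have d2 : is_derive r 1 (fun x : R => 1 - h x ^+ 2) (2 * r^-1 ^+ 3).
  have := @is_deriveB R _ R (cst 1) (h ^+ 2) r 1 _ _ (is_derive_cst _ _ _) (@is_deriveX R _ h 2 r 1 _ dh).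
  by move=> hh; apply: is_derive_eq hh _; rewrite /GRing.scale/= /h; ring.
have d3 : is_derive r 1 (fun x : R => (1 - h x ^+ 2) `^ e)
    (e * (1 - r^-1 ^+ 2) `^ (e - 1) * (2 * r^-1 ^+ 3)).
  apply: is_derive_ext (@is_derive1_comp R (fun y : R => y `^ e) (fun x : R => 1 - h x ^+ 2) r _ _ (@is_derive1_powR R e _ w0) d2) => //.
apply: is_derive_ext (is_deriveM d1 d3); first by move=> x; rewrite mulrfctE exprfctE.
rewrite /GRing.scale/= /phi.
have -> : (h ^+ a) r = r^-1 ^+ a by rewrite exprfctE.
(* The exponent [a.-1] is truncated at a = 0, where its coefficient vanishes. *)
case: a {d1} => [|a] /=; rewrite ?exprD !exprS; ring.
Qed.

Lemma continuous_phi a e r : 1 < r -> {for r, continuous (phi a e)}.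
Proof.
move=> r1; apply: differentiable_continuous; apply/derivable1_diffP.
by have [] := is_derive_phi a e r1.
Qed.

(** Multiply 1 = (1 - r^-2) + r^-2 by the function. *)
Lemma phi_split a e r : 1 < r -> phi a e r = phi a (e + 1) r + phi a.+2 e r.
Proof.
move=> r1; have w0 := radial_base_gt0 r1.
rewrite /phi powRD; last by rewrite (gt_eqF w0) implybT.
by rewrite powRr1 ?ltW// !exprS; ring.
Qed.

Lemma cvg_inv_y : (x : R)^-1 @[x --> +oo] --> (0 : R).
Proof.
apply/cvgrPdist_le => /= e e0; near=> x.
have x0 : e^-1 <= x by near: x; apply: nbhs_pinfty_ge; rewrite num_real.
have xp : 0 < x by apply: lt_le_trans x0; rewrite invr_gt0.
by rewrite sub0r normrN gtr0_norm ?invr_gt0// invf_ple.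
Unshelve. all: by end_near. Qed.

Lemma phi_cvg_y a e : 0 <= e -> phi a.+1 e x @[x --> +oo] --> (0 : R).
Proof.
move=> e0; apply: (@squeeze_cvgr _ _ _ _ (cst 0) (fun x : R => x^-1)); last 2 first.
  exact: cvg_cst.
  exact: cvg_inv_y.
near=> x; have x1 : 1 < x by near: x; apply: nbhs_pinfty_gt; rewrite num_real.
have x0 : 0 < x by apply: lt_trans x1.
have xi : 0 <= x^-1 by rewrite invr_ge0 ltW.
have w1 : 1 - x^-1 ^+ 2 <= 1 by rewrite gerBl exprn_ge0.
rewrite phi_ge0//= /phi -[leRHS]mulr1 ler_pM ?powR_ge0 ?exprn_ge0//.
  by rewrite exprS ler_piMr// exprn_ile1// invf_le1// ltW.
rewrite -[leRHS](_ : 1 `^ e = 1); last by rewrite powR1.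
by apply: ge0_ler_powR => //; rewrite nnegrE// ltW// radial_base_gt0.
Unshelve. all: by end_near. Qed.

Lemma cvg_inv_at_right1 : (x : R)^-1 @[x --> 1^'+] --> (1 : R).
Proof.
apply: cvg_at_right_filter; rewrite -[X in _ --> X]invr1.
by apply: cvgV; [exact: oner_neq0|exact: cvg_id].
Qed.

Lemma phi_cvg_1 a e : 0 < e -> phi a e x @[x --> 1^'+] --> (0 : R).
Proof.
move=> e0; rewrite -[X in _ --> X](mulr0 (1 ^+ a)); apply: cvgM.
  by apply: (@cvg_comp _ _ _ (fun x : R => x^-1) (fun y : R => y ^+ a) _ (nbhs (1:R)) _ cvg_inv_at_right1); exact: exprn_continuous.
(* The limit of the power at 0 is one-sided, so 1 - r^-2 must also be shown positive. *)
apply: (@cvg_comp _ _ _ (fun x : R => 1 - x^-1 ^+ 2) (fun y => y `^ e) _ (0^'+) _ _ (powR_cvg0 e0)).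
have h : (1 - x^-1 ^+ 2 : R) @[x --> 1^'+] --> (0 : R).
  rewrite -[X in _ --> X](subrr 1) -[in X in _ - X](expr1n _ 2).
  apply: cvgB; first exact: cvg_cst.
  by apply: (@cvg_comp _ _ _ (fun x : R => x^-1) (fun y : R => y ^+ 2) _ (nbhs (1:R)) _ cvg_inv_at_right1); exact: exprn_continuous.
move=> A [eps /= eps0 HA].
have /cvgrPdist_lt/(_ eps eps0) := h => hn.
near=> x; apply: HA => /=.
  by near: x.
apply: radial_base_gt0; near: x; exact: nbhs_right_gt.
Unshelve. all: by end_near. Qed.

(** By x = r^-2 this is half the beta integral B(k/2, d/2). *)
Definition radint k d : \bar R :=
  (\int[lebesgue_measure]_(r in `]1%R, +oo[) (phi k.+1 (d%:R / 2 - 1) r)%:E)%E.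

Lemma phi_measurable a e : measurable_fun `](1 : R), +oo[ (fun r : R => (phi a e r)%:E).
Proof.
apply/measurable_EFinP; apply: open_continuous_measurable_fun.
  exact: interval_open.
by move=> r; rewrite inE/= in_itv/= andbT => r1; exact: continuous_phi.
Qed.

Lemma phi_ge0E a e r : `]1%R, +oo[%classic r -> (0 <= (phi a e r)%:E)%E.
Proof. by rewrite /= in_itv/= andbT => r1; rewrite lee_fin phi_ge0. Qed.

(** Integration by parts with the primitive r^-k (1 - r^-2)^(d/2), which vanishes at 1 since d > 0
    and at infinity since k > 0. *)
Lemma radint_k k d : (0 < k)%N -> (0 < d)%N ->
  ((k + d)%:R%:E * radint k.+2 d = k%:R%:E * radint k d)%E.
Proof.
move=> k0 d0; rewrite /radint.
rewrite -!ge0_integralZl_EFin//; first last.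
- exact: phi_measurable.
- exact: phi_ge0E.
- exact: phi_measurable.
- exact: phi_ge0E.
have := @FTC2_open_ray R (fun r => k%:R * phi k.+1 (d%:R / 2 - 1) r)
  (fun r => (k + d)%:R * phi k.+3 (d%:R / 2 - 1) r) (phi k (d%:R / 2)) 1 0 0.
rewrite subr0 adde0; apply.
- move=> r r1; apply: is_derive_eq (is_derive_phi _ _ r1) _.
  have -> : phi k.+1 (d%:R / 2) r = phi k.+1 (d%:R / 2 - 1) r - phi k.+3 (d%:R / 2 - 1) r.
    by rewrite [in RHS](phi_split _ _ r1) subrK addrK.
  have -> : 2 * (d%:R / 2) = d%:R :> R by field.
  by rewrite addn3 natrD; ring.
- by move=> r r1; apply: continuousM; [exact: cvg_cst|exact: continuous_phi].
- by move=> r r1; apply: continuousM; [exact: cvg_cst|exact: continuous_phi].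
- by move=> r r1; rewrite mulr_ge0// phi_ge0.
- by move=> r r1; rewrite mulr_ge0// phi_ge0.
- by apply: phi_cvg_1; rewrite divr_gt0// ltr0n.
- by case: k k0 => // k _; apply: phi_cvg_y; rewrite divr_ge0.
Qed.

Lemma radint_d k d : (radint k d = radint k d.+2 + radint k.+2 d)%E.
Proof.
rewrite /radint -ge0_integralD//; first last.
- exact: phi_measurable.
- exact: phi_ge0E.
- exact: phi_measurable.
- exact: phi_ge0E.
apply: eq_integral => r; rewrite inE/= in_itv/= andbT => r1.
rewrite -EFinD (phi_split _ _ r1); congr (phi _ _ _ + _)%:E.
by rewrite -[d.+2]addn2 natrD; field.
Qed.

Lemma radint_primitive k d (F : R -> R) la ly :
  (forall r, 1 < r -> is_derive r 1 F (phi k.+1 (d%:R / 2 - 1) r)) ->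
  F x @[x --> 1^'+] --> la -> F x @[x --> +oo] --> ly ->
  radint k d = (ly - la)%:E.
Proof.
move=> dF F1 Fy.
have := @FTC2_open_ray R (cst 0) (phi k.+1 (d%:R / 2 - 1)) F 1 la ly.
rewrite integral0 add0e; apply => //.
- by move=> r r1; rewrite subr0; exact: dF.
- by move=> r _; exact: cvg_cst.
- by move=> r r1; exact: continuous_phi.
- by move=> r r1; exact: phi_ge0.
Qed.

Lemma radint_12 : radint 1 2 = 1%:E.
Proof.
have -> : (1 : R)%:E = (0 - -1)%:E by rewrite sub0r opprK.
apply: (@radint_primitive _ _ (fun x => - x^-1)).
- move=> r r1; have r0 : r != 0 by rewrite gt_eqF// (lt_trans _ r1).
  apply: is_derive_ext (is_deriveN (is_derive_inv r0)) => //.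
  by rewrite opprK /phi divff ?pnatr_eq0// subrr powRr0 mulr1.
- by apply: cvgN; exact: cvg_inv_at_right1.
- by rewrite -[X in _ --> X]oppr0; apply: cvgN; exact: cvg_inv_y.
Qed.

Lemma radint_22 : radint 2 2 = 2^-1%:E.
Proof.
have -> : (2^-1 : R)%:E = (0 - - 2^-1)%:E by rewrite sub0r opprK.
apply: (@radint_primitive _ _ (fun x => - 2^-1 * (x^-1 * x^-1))).
- move=> r r1; have r0 : r != 0 by rewrite gt_eqF// (lt_trans _ r1).
  have d1 := is_derive_inv r0.
  have H := is_deriveM (@is_derive_cst R R R (- 2^-1) r 1) (is_deriveM d1 d1).
  apply: is_derive_ext H => //.
  by rewrite /phi divff ?pnatr_eq0// subrr powRr0 mulr1 /GRing.scale/=; field.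
- have H : (- 2^-1 * (x^-1 * x^-1) : R) @[x --> 1^'+] --> (- 2^-1 * (1 * 1) : R).
    by apply: cvgM; [exact: cvg_cst|apply: cvgM; exact: cvg_inv_at_right1].
  by rewrite !mulr1 in H.
- have H : (- 2^-1 * (x^-1 * x^-1) : R) @[x --> +oo] --> (- 2^-1 * (0 * 0) : R).
    by apply: cvgM; [exact: cvg_cst|apply: cvgM; exact: cvg_inv_y].
  by rewrite !mulr0 in H.
Qed.

Lemma radint_21 : radint 2 1 = 1%:E.
Proof.
have -> : (1 : R)%:E = (1 - 0)%:E by rewrite subr0.
apply: (@radint_primitive _ _ (phi 0 (1 / 2))).
- move=> r r1; apply: is_derive_eq (is_derive_phi 0 (1/2) r1) _.
  have -> : 2 * (1 / 2) = 1 :> R by field.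
  by rewrite mul0r subr0 mul1r.
- by apply: phi_cvg_1; rewrite divr_gt0.
- apply: (@squeeze_cvgr _ _ _ _ (fun x : R => 1 - x^-1) (cst 1)); last 2 first.
    rewrite -[X in _ --> X](subr0 1); apply: cvgB; [exact: cvg_cst|exact: cvg_inv_y].
    exact: cvg_cst.
  near=> x; have x1 : 1 < x by near: x; apply: nbhs_pinfty_gt; rewrite num_real.
  have x0 : 0 < x by apply: lt_trans x1.
  have w0 := radial_base_gt0 x1.
  have w1 : 1 - x^-1 ^+ 2 <= 1 by rewrite gerBl exprn_ge0// invr_ge0 ltW.
  rewrite /phi expr0 mul1r; apply/andP; split.
    apply: (@le_trans _ _ (1 - x^-1 ^+ 2)).
      rewrite lerD2l lerN2 expr2 ger_pMr ?invr_gt0//.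
      by rewrite invf_le1// ltW.
    rewrite -{1}(powRr1 (ltW w0)); apply: ger_powR; first by rewrite w0.
    by rewrite ler_pdivrMr// mul1r ler1n.
  rewrite -[leRHS](_ : 1 `^ (1 / 2) = 1); last by rewrite powR1.
  by apply: ge0_ler_powR => //; rewrite nnegrE// ltW.
Unshelve. all: by end_near. Qed.

Lemma radint_11 : radint 1 1 = (pi / 2)%:E.
Proof.
have -> : (pi / 2 : R)%:E = (pi / 2 - 0)%:E by rewrite subr0.
apply: (@radint_primitive _ _ (fun r => atan (Num.sqrt (r * r - 1)))).
- move=> r r1; have r0 : 0 < r by apply: lt_trans r1.
  have v0 : 0 < r * r - 1 by rewrite subr_gt0; nra.
  have d1 : is_derive r 1 (fun r : R => r * r - 1) (r + r).
    have := @is_deriveB R _ R _ (cst 1) r 1 _ _ (is_deriveM (is_derive_id r 1) (is_derive_id r 1)) (is_derive_cst _ _ _).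
    by move=> h; apply: is_derive_eq h _; rewrite /GRing.scale/= !mulr1 subr0.
  have d2 := @is_derive1_comp R (fun y : R => y `^ (1/2)) (fun r : R => r * r - 1) r _ _ (@is_derive1_powR R (1/2) _ v0) d1.
  have d3 : is_derive (Num.sqrt (r * r - 1)) 1 (@atan R) (1 + Num.sqrt (r * r - 1) ^+ 2)^-1.
    exact: is_derive1_atan.
  have d4 : is_derive r 1 (fun r : R => Num.sqrt (r * r - 1)) (1/2 * (r * r - 1) `^ (1/2 - 1) * (r + r)).
    (* The power 1/2 and the square root are identified only at nonnegative arguments, hence only
       near r. *)
    apply: is_derive_near_ext d2.
    near=> x; rewrite /= mul1r powR12_sqrt//.
    rewrite subr_ge0; have : 1 < x by near: x; exact: lt_nbhsr.
    nra.
  apply: is_derive_ext (@is_derive1_comp R (@atan R) (fun r : R => Num.sqrt (r * r - 1)) r _ _ d3 d4) => //.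
  have w0 := radial_base_gt0 r1.
  rewrite sqr_sqrtr ?ltW// /phi.
  have -> : (1/2 - 1 : R) = - (1/2) by field.
  rewrite !powRN !mul1r !powR12_sqrt ?ltW//.
  have -> : Num.sqrt (1 - r^-1 ^+ 2) = r^-1 * Num.sqrt (r * r - 1).
    have -> : 1 - r^-1 ^+ 2 = r^-1 ^+ 2 * (r * r - 1) by field; rewrite gt_eqF.
    by rewrite sqrtrM ?sqr_ge0// sqrtr_sqr gtr0_norm// invr_gt0.
  have -> : 1 + (r * r - 1) = r * r by ring.
  have s0 : 0 < Num.sqrt (r * r - 1) by rewrite sqrtr_gt0.
  by field; rewrite !gt_eqF.
- have c : {for (1 : R), continuous (fun r : R => atan (Num.sqrt (r * r - 1)))}.
    apply: (@continuous_comp _ _ _ (fun r : R => Num.sqrt (r * r - 1)) (@atan R)); last exact: continuous_atan.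
    apply: (@continuous_comp _ _ _ (fun r : R => r * r - 1) (@Num.sqrt R)); last exact: sqrt_continuous.
    by apply: cvgB; [apply: cvgM; exact: cvg_id|exact: cvg_cst].
  have := cvg_at_right_filter c; by rewrite mulr1 subrr sqrtr0 atan0.
- apply: (@cvg_comp _ _ _ (fun r : R => Num.sqrt (r * r - 1)) (@atan R) _ _ _ _ (@cvgy_atan R)).
  apply/cvgryPge => A; near=> x.
  have A0 : 0 < `|A| + 1 by rewrite ltr_wpDl.
  apply: (@le_trans _ _ (`|A| + 1)); first by rewrite (le_trans (ler_norm _))// lerDl.
  rewrite -[leLHS]gtr0_norm// -sqrtr_sqr ler_wsqrtr//.
  have : `|A| + 2 <= x by near: x; apply: nbhs_pinfty_ge; rewrite num_real.
  by have := normr_ge0 A; nra.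
Unshelve. all: by end_near. Qed.

(** * Normalisation *)

Definition gint (x : R) : \bar R :=
  (\int[lebesgue_measure]_(t in `]0%R, +oo[) (t `^ (x - 1) * expR (- t))%:E)%E.

Lemma GammaE (x : R) : Gamma x = fine (gint x). Proof. by []. Qed.

Lemma gint_ge0 x : (0 <= gint x)%E.
Proof. by apply: integral_ge0 => t _; rewrite lee_fin mulr_ge0 ?powR_ge0 ?expR_ge0. Qed.

Lemma is_derive_expRN (t : R) : is_derive t 1 (fun t : R => expR (- t)) (- expR (- t)).
Proof.
apply: is_derive_ext (@is_derive1_comp R expR (fun t : R => - t) t _ _ (is_derive_expR _) (is_deriveN (is_derive_id t 1))) => //.
by rewrite mulrN1.
Qed.

Lemma is_derive_gint x (t : R) : 0 < t ->
  is_derive t 1 (fun t : R => t `^ x * expR (- t))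
    (x * (t `^ (x - 1) * expR (- t)) - t `^ x * expR (- t)).
Proof.
move=> t0.
apply: is_derive_ext (is_deriveM (@is_derive1_powR R x t t0) (is_derive_expRN t)) => //.
by rewrite /GRing.scale/=; ring.
Qed.

Lemma continuous_gint x (t : R) : 0 < t ->
  {for t, continuous (fun t : R => t `^ x * expR (- t))}.
Proof.
move=> t0; apply: differentiable_continuous; apply/derivable1_diffP.
by have [] := is_derive_gint x t0.
Qed.

Lemma powR_expRN_cvg_y x : 0 <= x -> (t `^ x * expR (- t) : R) @[t --> +oo] --> (0 : R).
Proof.
move=> x0; pose n := (Num.truncn x).+1.
apply: (@squeeze_cvgr _ _ _ _ (cst 0) (fun t : R => n.+1`!%:R * t^-1)); last 2 first.
- exact: cvg_cst.
- by rewrite -[X in _ --> X](mulr0 (n.+1`!%:R : R)); apply: cvgM; [exact: cvg_cst|exact: cvg_inv_y].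
near=> t; have t1 : 1 <= t by near: t; apply: nbhs_pinfty_ge; rewrite num_real.
have t0 : 0 < t by apply: lt_le_trans t1.
have f0 : (0 : R) < n.+1`!%:R by rewrite ltr0n fact_gt0.
rewrite mulr_ge0 ?powR_ge0 ?expR_ge0//=.
apply: (@le_trans _ _ (t ^+ n * expR (- t))).
  rewrite ler_wpM2r ?expR_ge0// -(powR_mulrn n (ltW t0)); apply: ler_powR => //.
  by apply: ltW; rewrite /n truncnS_gt.
rewrite expRN ler_pdivrMr ?expR_gt0// mulrAC ler_pdivlMr// -exprSr.
rewrite mulrC -ler_pdivrMr//; apply: le_trans (expR_ge1Dxn n (ltW t0)).
by rewrite lerDr.
Unshelve. all: by end_near. Qed.

Lemma gint_measurable x : measurable_fun `](0 : R), +oo[ (fun t : R => (t `^ x * expR (- t))%:E).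
Proof.
apply/measurable_EFinP; apply: open_continuous_measurable_fun.
  exact: interval_open.
by move=> r; rewrite inE/= in_itv/= andbT => r1; exact: continuous_gint.
Qed.

Lemma gintS x : 0 < x -> (gint (x + 1) = x%:E * gint x)%E.
Proof.
move=> x0; rewrite /gint -ge0_integralZl_EFin//; last 3 first.
- by move=> t _; rewrite lee_fin mulr_ge0 ?powR_ge0 ?expR_ge0.
- exact: gint_measurable.
- exact: ltW.
have := @FTC2_open_ray R (fun t => t `^ x * expR (- t)) (fun t => x * (t `^ (x - 1) * expR (- t)))
  (fun t => t `^ x * expR (- t)) 0 0 0.
rewrite subr0 adde0 addrK => H; apply/esym; apply: H.
- by move=> t t0; exact: is_derive_gint.
- by move=> t t0; exact: continuous_gint.
- by move=> t t0; apply: continuousM; [exact: cvg_cst|exact: continuous_gint].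
- by move=> t t0; rewrite mulr_ge0 ?powR_ge0 ?expR_ge0.
- by move=> t t0; rewrite mulr_ge0 ?(ltW x0)// mulr_ge0 ?powR_ge0 ?expR_ge0.
- rewrite -[X in _ --> X](mul0r (expR (- 0) : R)); apply: cvgM; first exact: powR_cvg0.
  apply: cvg_at_right_filter; apply: (@continuous_comp _ _ _ (fun t : R => - t) expR).
    exact: opp_continuous.
  exact: continuous_expR.
- exact/powR_expRN_cvg_y/ltW.
Qed.

Lemma GammaS (x : R) : 0 < x -> Gamma (x + 1) = x * Gamma x.
Proof.
move=> x0; rewrite !GammaE gintS//; have := gint_ge0 x.
(* An infinite integral would make both sides 0, because [fine] sends +oo to 0. *)
by case: (gint x) => //= _; rewrite mulry gtr0_sg// mul1e/= mulr0.
Qed.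

Lemma Gamma1 : Gamma (1 : R) = 1.
Proof.
rewrite GammaE; suff -> : gint 1 = 1%:E by [].
have := @FTC2_open_ray R (cst 0) (fun t => t `^ (1 - 1) * expR (- t)) (fun t => - expR (- t)) 0 (-1) 0.
rewrite integral0 add0e sub0r opprK; apply.
- move=> t t0; apply: is_derive_ext (is_deriveN (is_derive_expRN t)) => //.
  by rewrite subrr powRr0 mul1r subr0 opprK.
- by move=> t t0; exact: cvg_cst.
- by move=> t t0; exact: continuous_gint.
- by [].
- by move=> t t0; rewrite mulr_ge0 ?powR_ge0 ?expR_ge0.
- have c : {for (0 : R), continuous (fun t : R => - expR (- t))}.
    apply: differentiable_continuous; apply/derivable1_diffP.
    by have [] := is_deriveN (is_derive_expRN 0).
  by have := cvg_at_right_filter c; rewrite oppr0 expR0.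
- by rewrite -[X in _ --> X]oppr0; apply: cvgN; exact: cvgr_expR.
Qed.

(** The substitution t = y^2 is made on primitives: with [G] the truncated Gauss integral, 2 G(sqrt
    t) has the Gamma integrand as its derivative. *)
Lemma Gamma_half : Gamma (1 / 2 : R) = Num.sqrt pi.
Proof.
pose G (x : R) : R := (\int[lebesgue_measure]_(t in `[0%R, x]) gauss_fun t)%R.
have G0 x : 0 <= G x by apply: Rintegral_ge0 => //= y _; exact: gauss_fun_ge0.
have intG x : lebesgue_measure.-integrable `[0, x] (EFin \o @gauss_fun R).
  apply: continuous_compact_integrable => //; first exact: segment_compact.
  by apply: continuous_subspaceT; exact: continuous_gauss_fun.
have dG (x : R) : 0 < x -> is_derive x 1 G (gauss_fun x).
  move=> x0; have [] := @continuous_FTC1 R gauss_fun (BLeft 0) x (x + 1) _ _ _ _.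
  - by rewrite ltrDl.
  - exact: intG.
  - by rewrite /= lte_fin.
  - by move=> ?; exact: continuous_gauss_fun.
  move=> h1 h2; split; first exact: h1.
  by rewrite -derive1E; exact: h2.
have G00 : G x @[x --> (0 : R)] --> (0 : R) := parameterized_integral_cvg_left ltr01 (intG 1).
have Gy : G x @[x --> +oo] --> Num.sqrt pi / 2.
  have H : (Num.sqrt (G x ^+ 2) : R) @[x --> +oo] --> Num.sqrt (pi / 4 : R).
    apply: continuous_cvg => //; [exact: sqrt_continuous|].
    exact: gauss_integral_proof.cvg_integral0_gauss_sqr.
  have E : (fun x => Num.sqrt (G x ^+ 2)) = G.
    by apply/funext => x; rewrite sqrtr_sqr ger0_norm.
  rewrite E in H; suff <- : Num.sqrt (pi / 4 : R) = Num.sqrt pi / 2 by [].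
  rewrite (_ : 4 = 2 ^+ 2 :> R); last by rewrite -natrX.
  by rewrite sqrtrM ?pi_ge0// -exprVn sqrtr_sqr ger0_norm.
have dsqrt (t : R) : 0 < t -> is_derive t 1 (@Num.sqrt R) (1 / 2 * t `^ (1 / 2 - 1)).
  move=> t0; apply: is_derive_near_ext (@is_derive1_powR R (1/2) t t0).
  by near=> x; rewrite /= mul1r powR12_sqrt// ltW//; near: x; exact: lt_nbhsr.
rewrite GammaE; suff -> : gint (1 / 2) = (Num.sqrt pi)%:E by [].
have := @FTC2_open_ray R (cst 0) (fun t => t `^ (1 / 2 - 1) * expR (- t))
  (fun t => 2 * G (Num.sqrt t)) 0 0 (Num.sqrt pi).
rewrite integral0 add0e subr0; apply.
- move=> t t0.
  have st0 : 0 < Num.sqrt t by rewrite sqrtr_gt0.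
  have H := is_deriveM (@is_derive_cst R R R 2 t 1) (@is_derive1_comp R G (@Num.sqrt R) t _ _ (dG _ st0) (dsqrt _ t0)).
  apply: is_derive_ext H => //.
  by rewrite /GRing.scale/= subr0 /gauss_fun sqr_sqrtr ?ltW//; field.
- by move=> t t0; exact: cvg_cst.
- by move=> t t0; exact: continuous_gint.
- by [].
- by move=> t t0; rewrite mulr_ge0 ?powR_ge0 ?expR_ge0.
- have H : (2 * G (Num.sqrt t) : R) @[t --> 0^'+] --> (2 * 0 : R).
    apply: cvgM; first exact: cvg_cst.
    apply: (@cvg_comp _ _ _ (@Num.sqrt R) G _ (nbhs (0 : R)) _ _ G00).
    by have := cvg_at_right_filter (@sqrt_continuous R 0); rewrite sqrtr0.
  by rewrite mulr0 in H.
- have -> : Num.sqrt pi = 2 * (Num.sqrt pi / 2) :> R by field.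
  apply: cvgM; first exact: cvg_cst.
  apply: (@cvg_comp _ _ _ (@Num.sqrt R) G _ _ _ _ Gy).
  apply/cvgryPge => A; near=> x.
  apply: (@le_trans _ _ (`|A|)); first exact: ler_norm.
  rewrite -[leLHS]normr_id -sqrtr_sqr ler_wsqrtr//.
Unshelve. all: by end_near. Qed.

Lemma omega1 : omega R 1 = 2.
Proof.
rewrite /omega Gamma_half mul1r powR12_sqrt ?pi_ge0// mulfK// gt_eqF//.
by rewrite sqrtr_gt0 pi_gt0.
Qed.

Lemma omega2 : omega R 2 = 2 * pi.
Proof. by rewrite /omega divff// powRr1 ?pi_ge0// Gamma1 divr1. Qed.

Lemma omegaSS k : (0 < k)%N -> omega R k.+2 = 2 * pi / k%:R * omega R k.
Proof.
move=> k0; have k0' : (0 : R) < k%:R by rewrite ltr0n.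
have E : k.+2%:R / 2 = k%:R / 2 + 1 :> R by rewrite -[k.+2]addn2 natrD; field.
rewrite /omega E GammaS ?divr_gt0//.
rewrite powRD; last by rewrite (gt_eqF (pi_gt0 R)) implybT.
rewrite powRr1 ?pi_ge0// !invfM invrK.
by ring.
Qed.

Lemma omega_gt0 k : (0 < k)%N -> 0 < omega R k.
Proof.
case: k => // k _; suff : 0 < omega R k.+1 /\ 0 < omega R k.+2 by case.
elim: k => [|k [h1 h2]].
  by rewrite omega1 omega2 pmulr_rgt0// pi_gt0; split.
split; first exact: h2.
rewrite omegaSS// pmulr_lgt0//; apply: divr_gt0; last by rewrite ltr0n.
by rewrite pmulr_rgt0// pi_gt0.
Qed.

(** The recurrences for [omega] and [radint] raise an index by two, hence two base cases. *)
Lemma pair_ind (P : nat -> Prop) : P 1%N -> P 2%N -> (forall k, (0 < k)%N -> P k -> P k.+2) ->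
  forall k, (0 < k)%N -> P k.
Proof.
move=> h1 h2 h; case=> // k _; suff : P k.+1 /\ P k.+2 by case.
by elim: k => [|k [? ?]]; split=> //; apply: h.
Qed.

(** The algebra of the induction steps, with variables in place of the values of [omega] and [pi],
    so that [field] meets only atoms. *)
Let radint_alg1 (K D a b c p : R) : K != 0 -> K + D != 0 -> b != 0 -> c != 0 -> p != 0 ->
  (K + D)^-1 * K * (a / (b * c)) = 2 * p / (K + D) * a / (2 * p / K * b * c).
Proof. by move=> *; field; do !(apply/andP; split). Qed.

Let radint_alg2 (K D a b c p : R) : K != 0 -> D != 0 -> K + D != 0 -> b != 0 -> c != 0 -> p != 0 ->
  a / (b * c) - 2 * p / (K + D) * a / (2 * p / K * b * c) = 2 * p / (K + D) * a / (b * (2 * p / D * c)).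
Proof. by move=> *; field; do !(apply/andP; split). Qed.

(** Both sides obey the recurrences [radint_k] and [radint_d], the right one because of [omegaSS];
    the four cases with k, d in {1, 2} start the induction. This gives the radial density total mass
    one. *)
Lemma radintE k d : (0 < k)%N -> (0 < d)%N ->
  radint k d = (omega R (k + d) / (omega R k * omega R d))%:E.
Proof.
have w n : (0 < n)%N -> omega R n != 0 by move=> /omega_gt0 h; rewrite gt_eqF.
have pn : pi != 0 :> R by rewrite gt_eqF// pi_gt0.
have Sk k' d' : (0 < k')%N -> (0 < d')%N ->
  radint k' d' = (omega R (k' + d') / (omega R k' * omega R d'))%:E ->
  radint k'.+2 d' = (omega R (k'.+2 + d') / (omega R k'.+2 * omega R d'))%:E.
  move=> k0 d0 H; have := radint_k k0 d0; rewrite H.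
  have kd0 : (k' + d')%:R != 0 :> R by rewrite pnatr_eq0 -lt0n addn_gt0 k0.
  have k0' : k'%:R != 0 :> R by rewrite pnatr_eq0 -lt0n.
  move/(congr1 (mule ((k' + d')%:R^-1)%:E)); rewrite !muleA -!EFinM mulVf// mul1e => ->.
  congr (_%:E); rewrite !addSn omegaSS ?addn_gt0 ?k0// omegaSS//.
  by rewrite natrD; apply: radint_alg1 => //; rewrite -?natrD ?w.
have base d' : d' \in [:: 1; 2]%N -> forall k', (0 < k')%N ->
   radint k' d' = (omega R (k' + d') / (omega R k' * omega R d'))%:E.
  move=> hd; apply: pair_ind; last first.
  - by move=> k' k0 H; apply: Sk => //; case/or3P: hd => // /eqP ->.
  - move: hd; rewrite !inE => /orP[] /eqP ->.
      rewrite radint_21 addn1 omegaSS// omega1 omega2; congr (_%:E).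
      by move: (pi : R) pn => p p0; field; do ?(apply/andP; split).
    rewrite radint_22 addn2 omegaSS// omega2; congr (_%:E).
    by move: (pi : R) pn => p p0; field; do ?(apply/andP; split).
  - move: hd; rewrite !inE => /orP[] /eqP ->.
      rewrite radint_11 addn1 omega1 omega2; congr (_%:E).
      by move: (pi : R) pn => p p0; field; do ?(apply/andP; split).
    rewrite radint_12 add1n omegaSS// omega1 omega2; congr (_%:E).
    by move: (pi : R) pn => p p0; field; do ?(apply/andP; split).
move=> k0 d0; move: d d0 k k0; apply: pair_ind; [exact: base|exact: base|].
move=> d d0 H k k0.
have kd0 : (k + d)%:R != 0 :> R by rewrite pnatr_eq0 -lt0n addn_gt0 k0.
have kn0 : k%:R != 0 :> R by rewrite pnatr_eq0 -lt0n.
have dn0 : d%:R != 0 :> R by rewrite pnatr_eq0 -lt0n.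
have Ed := radint_d k d; rewrite H// (Sk _ _ k0 d0 (H _ k0)) in Ed.
have sub (X : \bar R) (c c' : R) : (c%:E = X + c'%:E)%E -> X = (c - c')%:E.
  by case: X => //= x [->]; rewrite addrK.
rewrite (sub _ _ _ Ed).
congr (_%:E).
rewrite !addSn !addnS omegaSS ?addn_gt0 ?k0// omegaSS// [omega R d.+2]omegaSS//.
by rewrite natrD; apply: radint_alg2 => //; rewrite -?natrD ?w.
Qed.
End radial.

(** * Determinacy by moments *)

Section step_approximation.
Variable R : realType.
Implicit Types (x t : R) (n : nat).

(** An integer exponent close to n / t^n, so that the approximation of the step stays a polynomial
    in x and integrates to a combination of moments. *)
Definition step_exp t n : nat := (Num.truncn (n%:R / t ^+ n)).+1.

Lemma step_exp_ge t n : n%:R / t ^+ n <= (step_exp t n)%:R.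
Proof. exact/ltW/truncnS_gt. Qed.

Lemma step_exp_le t n : 0 < t -> (step_exp t n)%:R <= n%:R / t ^+ n + 1.
Proof.
move=> t0; rewrite /step_exp -natr1 lerD2r truncn_le//.
by rewrite divr_ge0// exprn_ge0// ltW.
Qed.

Lemma bernoulli_ge x n : 0 <= x <= 1 -> 1 - n%:R * x <= (1 - x) ^+ n.
Proof.
move=> /andP[x0 x1]; elim: n => [|n IH]; first by rewrite mul0r subr0 expr0.
rewrite exprS; apply: (@le_trans _ _ ((1 - x) * (1 - n%:R * x))).
  by rewrite -natr1; have : 0 <= (n%:R : R) by []; nra.
by rewrite ler_wpM2l// subr_ge0.
Qed.

Lemma bernoulli_le x n : 0 <= x <= 1 -> (1 - x) ^+ n * (1 + n%:R * x) <= 1.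
Proof.
move=> /andP[x0 x1].
have h : 1 + n%:R * x <= (1 + x) ^+ n.
  elim: n => [|n IH]; first by rewrite mul0r addr0 expr0.
  rewrite exprS; apply: (@le_trans _ _ ((1 + x) * (1 + n%:R * x))).
    by rewrite -natr1; have : 0 <= (n%:R : R) by []; nra.
  by rewrite ler_wpM2l// addr_ge0.
apply: (@le_trans _ _ ((1 - x) ^+ n * (1 + x) ^+ n)).
  by rewrite ler_wpM2l// exprn_ge0// subr_ge0.
by rewrite -exprMn exprn_ile1//; nra.
Qed.

(** With x = s^2 it suffices that n s^n is bounded: by Bernoulli s^-n >= 1 + n h for h = 1/s - 1, so
    n s^n <= 1/h. *)
Lemma cvg_natM_geo x : 0 <= x < 1 -> (n%:R * x ^+ n : R) @[n --> \oo] --> (0 : R).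
Proof.
move=> /andP[x0 x1].
have [->|xn0] := eqVneq x 0.
  suff -> : (fun n => n%:R * 0 ^+ n) = cst (0 : R) by exact: cvg_cst.
  by apply/funext => -[|n]; rewrite ?mul0r// exprS mul0r mulr0.
have xp : 0 < x by rewrite lt_def xn0.
pose s := Num.sqrt x.
have s0 : 0 < s by rewrite sqrtr_gt0.
have s1 : s < 1 by rewrite -(@sqrtr1 R) ltr_sqrt.
have sx : x = s * s by rewrite -expr2 sqr_sqrtr.
pose h := s^-1 - 1.
have h0 : 0 < h by rewrite subr_gt0 invf_gt1.
apply: (@squeeze_cvgr _ _ _ _ (cst 0) (fun n => h^-1 * s ^+ n)); last 2 first.
- exact: cvg_cst.
- rewrite -[X in _ --> X](mulr0 h^-1); apply: cvgM; first exact: cvg_cst.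
  by apply: cvg_expr; rewrite gtr0_norm.
apply: nearW => n /=; rewrite mulr_ge0 ?exprn_ge0//=.
rewrite sx exprMn mulrA ler_wpM2r ?exprn_ge0 ?(ltW s0)//.
have key : 1 + n%:R * h <= s^-1 ^+ n.
  rewrite -[s^-1](subrK 1) -/h [h + 1]addrC.
  elim: n => [|n IH]; first by rewrite mul0r addr0 expr0.
  rewrite exprS; apply: (@le_trans _ _ ((1 + h) * (1 + n%:R * h))).
    by rewrite -natr1; have : 0 <= (n%:R : R) by []; nra.
  by rewrite ler_wpM2l// addr_ge0// ltW.
rewrite -[leRHS]mul1r ler_pdivlMr//.
apply: (@le_trans _ _ (s^-1 ^+ n * s ^+ n)); last first.
  by rewrite exprVn mulVf// expf_neq0// gt_eqF.
rewrite mulrAC ler_wpM2r ?exprn_ge0 ?(ltW s0)//.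
by apply: le_trans key; rewrite lerDr.
Qed.

(** Write N for the exponent. For x < t, Bernoulli gives the lower bound 1 - N x^n, and N x^n <= n
    (x/t)^n + x^n tends to 0. For x >= t it gives the upper bound 1 / (1 + N x^n) <= 1 / (1 + n).
    The point x = t falls on the side of 0, hence the open rays below. *)
Lemma step_cvg x t : 0 <= x <= 1 -> 0 < t <= 1 ->
  ((1 - x ^+ n) ^+ step_exp t n : R) @[n --> \oo] --> ((x < t)%R%:R : R).
Proof.
move=> /andP[x0 x1] /andP[t0 t1].
have xn n : 0 <= x ^+ n <= 1 by rewrite exprn_ge0// exprn_ile1.
have tn n : 0 < t ^+ n by rewrite exprn_gt0.
have [xt|tx] := ltP x t.
  have xl1 : x < 1 by apply: lt_le_trans t1.
  apply: (@squeeze_cvgr _ _ _ _ (fun n => 1 - (n%:R * (x / t) ^+ n + x ^+ n)) (cst 1)); last 2 first.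
  - rewrite -[X in _ --> X](subr0 1); apply: cvgB; first exact: cvg_cst.
    rewrite -[X in _ --> X](addr0 0); apply: cvgD.
      by apply: cvg_natM_geo; rewrite divr_ge0 ?(ltW t0)//= ltr_pdivrMr// mul1r.
    by apply: cvg_expr; rewrite ger0_norm.
  - exact: cvg_cst.
  apply: nearW => n /=; apply/andP; split; last first.
    by rewrite exprn_ile1// ?subr_ge0 ?gerBl; case/andP: (xn n).
  apply: le_trans (bernoulli_ge _ (xn n)); rewrite lerD2l lerN2.
  have -> : n%:R * (x / t) ^+ n + x ^+ n = (n%:R / t ^+ n + 1) * x ^+ n.
    by rewrite expr_div_n mulrDl mul1r mulrA mulrAC.
  by rewrite ler_wpM2r ?step_exp_le// exprn_ge0.
apply: (@squeeze_cvgr _ _ _ _ (cst 0) (fun n => (n.+1%:R : R)^-1)); last 2 first.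
- exact: cvg_cst.
- exact: cvg_harmonic.
apply: nearW => n /=; apply/andP; split.
  by rewrite exprn_ge0// subr_ge0; case/andP: (xn n).
rewrite -[leRHS]mul1r ler_pdivlMr// ?ltr0n//.
apply: le_trans (bernoulli_le (step_exp t n) (xn n)).
rewrite ler_wpM2l ?exprn_ge0 ?subr_ge0//; first by case/andP: (xn n).
rewrite -natr1 addrC lerD2l.
apply: (@le_trans _ _ (n%:R / t ^+ n * x ^+ n)); last first.
  by rewrite ler_wpM2r ?step_exp_ge// exprn_ge0.
rewrite -mulrA ler_peMr// mulrC ler_pdivlMr// mul1r lerXn2r// nnegrE// ltW//.
Qed.

End step_approximation.

(* The law of [X] under the measure with density [f] on [D]; the proof arguments
   let the measure instance below be inferred. *)
Definition wlaw d (T : measurableType d) (R : realType) (m : {measure set T -> \bar R})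
  (D : set T) (X f : T -> R) (mD : measurable D) (mX : measurable_fun setT X)
  (mf : measurable_fun D f) (f0 : forall x, D x -> 0 <= f x) (C : set R) : \bar R :=
  (\int[m]_(x in D `&` X @^-1` C) (f x)%:E)%E.

Section wlaw_measure.
Context d (T : measurableType d) (R : realType) (m : {measure set T -> \bar R}).
Variables (D : set T) (X f : T -> R) (mD : measurable D) (mX : measurable_fun setT X)
  (mf : measurable_fun D f) (f0 : forall x, D x -> 0 <= f x).

Local Notation law := (@wlaw d T R m D X f mD mX mf f0).

Let mDX (C : set R) : measurable C -> measurable (D `&` X @^-1` C).
Proof. by move=> mC; apply: measurableI => //; rewrite -[X in measurable X]setTI; exact: mX. Qed.

Let wlaw0 : law set0 = 0%E.
Proof. by rewrite /wlaw preimage_set0 setI0 integral_set0. Qed.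

Let wlaw_ge0 C : (0 <= law C)%E.
Proof. by apply: integral_ge0 => x [Dx _]; rewrite lee_fin f0. Qed.

Let wlaw_sigma_additive : semi_sigma_additive law.
Proof.
move=> /= F mF tF mUF; rewrite /wlaw; apply: cvg_toP.
  apply: ereal_nondecreasing_is_cvgn => p q pq.
  by apply: lee_sum_nneg_natr => // k _ _; exact: wlaw_ge0.
rewrite preimage_bigcup setI_bigcupr ge0_integral_bigcup//=.
- by move=> k; exact: mDX.
- apply/measurable_EFinP; apply: measurable_funS mf => //.
  by move=> x [k _ []].
- by move=> x [k _ [Dx _]]; rewrite lee_fin f0.
- apply/trivIsetP => i j _ _ ij; rewrite setIACA setIid -preimage_setI.
  by move/trivIsetP : tF => ->//; rewrite preimage_set0 setI0.
Qed.

HB.instance Definition _ := isMeasure.Build _ _ _ law wlaw0 wlaw_ge0 wlaw_sigma_additive.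

Hypothesis X01 : forall x, D x -> 0 <= X x <= 1.
Hypothesis fi : m.-integrable D (EFin \o f).

Let bounded_mul_integrable (h : T -> R) : measurable_fun D h -> (forall x, D x -> `|h x| <= 1) ->
  m.-integrable D (EFin \o (fun x => h x * f x)).
Proof.
move=> mh h1; apply: (le_integrable mD _ _ fi).
  by apply/measurable_EFinP; apply: measurable_funM.
move=> x Dx /=; rewrite lee_fin normrM ler_piMl//; exact: h1.
Qed.

Lemma wlaw_ray_cvg t : 0 < t <= 1 ->
  (\int[m]_(x in D) ((1 - X x ^+ n) ^+ step_exp t n * f x)%:E)%E @[n --> \oo] --> law `]-oo, t[.
Proof.
move=> t01.
have mXD : measurable_fun D X by apply: measurable_funS mX.
have -> : law `]-oo, t[ = (\int[m]_(x in D) ((X x < t)%R%:R * f x)%:E)%E.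
  rewrite /wlaw integral_mkcondr; apply: eq_integral => x _; rewrite patchE.
  case: ifPn => h.
    have /= : (X @^-1` `]-oo, t[) x by exact: set_mem.
    by rewrite in_itv/= => ->; rewrite mul1r.
  have : ~ (X @^-1` `]-oo, t[) x by move/mem_set; rewrite (negbTE h).
  by rewrite /= in_itv/= => /negP/negbTE ->; rewrite mul0r.
apply: (@dominated_cvg _ _ _ _ _ _ _ _ (fun x => (f x)%:E)) => //.
- move=> n; apply/measurable_EFinP; apply: measurable_funM => //.
  apply: measurable_funX; apply: measurable_funB => //; exact: measurable_funX.
- move=> x Dx; apply: cvg_EFin; first exact: nearW.
  by apply: cvgM; [exact: step_cvg (X01 Dx) t01|exact: cvg_cst].
- move=> n x Dx; rewrite /= lee_fin normrM (ger0_norm (f0 Dx)) ler_piMl ?f0//.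
  have /andP[h0 h1] := X01 Dx.
  have h2 : 0 <= X x ^+ n <= 1 by rewrite exprn_ge0// exprn_ile1.
  rewrite ger0_norm ?exprn_ge0 ?subr_ge0 ?exprn_ile1// ?subr_ge0 ?gerBl//; by case/andP: h2.
Qed.

Lemma wlaw_poly (p : {poly R}) :
  (\int[m]_(x in D) (p.[X x] * f x)%:E =
   \sum_(i < size p) (p`_i)%:E * \int[m]_(x in D) (X x ^+ i * f x)%:E)%E.
Proof.
have mXD : measurable_fun D X by apply: measurable_funS mX.
have ii i : m.-integrable D (fun x => (X x ^+ i * f x)%:E).
  apply: bounded_mul_integrable; first exact: measurable_funX.
  by move=> x /X01/andP[h0 h1]; rewrite ger0_norm ?exprn_ge0// exprn_ile1.
under eq_integral do rewrite horner_coef mulr_suml -sumEFin.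
rewrite integral_sum//; last first.
  move=> i; under [X in _.-integrable _ X]eq_fun do rewrite -mulrA EFinM.
  exact: integrableZl.
apply: eq_bigr => i _; rewrite -integralZl//.
by apply: eq_integral => x _; rewrite -mulrA EFinM.
Qed.

End wlaw_measure.

(** Dominated convergence turns equal moments into equal masses of the rays ]-oo, t[, a pi-system
    generating the Borel sets. The approximation serves for 0 < t <= 1; for t <= 0 both masses
    vanish, and for t > 1 the zeroth moments are compared. *)
Lemma wlaw_moment_unique d1 (T1 : measurableType d1) d2 (T2 : measurableType d2) (R : realType)
  (m1 : {measure set T1 -> \bar R}) (D1 : set T1) (X1 f1 : T1 -> R)
  (mD1 : measurable D1) (mX1 : measurable_fun setT X1)
  (mf1 : measurable_fun D1 f1) (p1 : forall x, D1 x -> 0 <= f1 x)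
  (m2 : {measure set T2 -> \bar R}) (D2 : set T2) (X2 f2 : T2 -> R)
  (mD2 : measurable D2) (mX2 : measurable_fun setT X2)
  (mf2 : measurable_fun D2 f2) (p2 : forall x, D2 x -> 0 <= f2 x) :
  (forall x, D1 x -> 0 <= X1 x <= 1) -> (forall x, D2 x -> 0 <= X2 x <= 1) ->
  m1.-integrable D1 (EFin \o f1) -> m2.-integrable D2 (EFin \o f2) ->
  (forall j, \int[m1]_(x in D1) (X1 x ^+ j * f1 x)%:E = \int[m2]_(x in D2) (X2 x ^+ j * f2 x)%:E)%E ->
  forall C : set R, measurable C ->
  (\int[m1]_(x in D1 `&` X1 @^-1` C) (f1 x)%:E = \int[m2]_(x in D2 `&` X2 @^-1` C) (f2 x)%:E)%E.
Proof.
move=> X1b X2b i1 i2 mom C mC.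
pose L1 := @wlaw _ _ R m1 D1 X1 f1 mD1 mX1 mf1 p1.
pose L2 := @wlaw _ _ R m2 D2 X2 f2 mD2 mX2 mf2 p2.
have ray (t : R) : L1 `]-oo, t[%classic = L2 `]-oo, t[%classic.
  have [t0|t0] := leP t 0.
    rewrite /L1 /L2 /wlaw.
    have -> : D1 `&` X1 @^-1` `]-oo, t[ = set0.
      apply/seteqP; split => // x [/X1b/andP[h _]] /=; rewrite in_itv/= => h'.
      by have := le_lt_trans h (lt_le_trans h' t0); rewrite ltxx.
    have -> : D2 `&` X2 @^-1` `]-oo, t[ = set0.
      apply/seteqP; split => // x [/X2b/andP[h _]] /=; rewrite in_itv/= => h'.
      by have := le_lt_trans h (lt_le_trans h' t0); rewrite ltxx.
    by rewrite !integral_set0.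
  have [t1|t1] := leP t 1; last first.
    rewrite /L1 /L2 /wlaw.
    have -> : D1 `&` X1 @^-1` `]-oo, t[ = D1.
      apply/seteqP; split => [x []//|x Dx]; split => //=; rewrite in_itv/=.
      by have /andP[_ h] := X1b _ Dx; apply: le_lt_trans t1.
    have -> : D2 `&` X2 @^-1` `]-oo, t[ = D2.
      apply/seteqP; split => [x []//|x Dx]; split => //=; rewrite in_itv/=.
      by have /andP[_ h] := X2b _ Dx; apply: le_lt_trans t1.
    by have := mom 0%N; under eq_integral do rewrite expr0 mul1r;
       under [in RHS]eq_integral do rewrite expr0 mul1r.
  have t01 : 0 < t <= 1 by rewrite t0.
  have c1 := @wlaw_ray_cvg _ _ R m1 D1 X1 f1 mD1 mX1 mf1 p1 X1b i1 t t01.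
  have c2 := @wlaw_ray_cvg _ _ R m2 D2 X2 f2 mD2 mX2 mf2 p2 X2b i2 t t01.
  rewrite -/L1 in c1; rewrite -/L2 in c2.
  suff E : (fun n => \int[m1]_(x in D1) ((1 - X1 x ^+ n) ^+ step_exp t n * f1 x)%:E)%E =
            (fun n => \int[m2]_(x in D2) ((1 - X2 x ^+ n) ^+ step_exp t n * f2 x)%:E)%E.
    by rewrite E in c1; exact: (cvg_unique _ c1 c2).
  apply/funext => n; pose p : {poly R} := (1 - 'X^n) ^+ step_exp t n.
  have pE x : (1 - x ^+ n) ^+ step_exp t n = p.[x] by rewrite /p !hornerE.
  under eq_integral do rewrite pE.
  under [RHS]eq_integral do rewrite pE.
  rewrite (wlaw_poly mD1 mX1 mf1 X1b i1) (wlaw_poly mD2 mX2 mf2 X2b i2).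
  by apply: eq_bigr => i _; rewrite mom.
have fin0 : (\int[m1]_(x in D1) (f1 x)%:E < +oo)%E.
  have /integrableP[_] := i1; congr (_ < _)%E; apply: eq_integral => x.
  by rewrite inE => Dx; rewrite gee0_abs//= lee_fin p1.
have fin1 A : measurable A -> (L1 A < +oo)%E.
  move=> mA; rewrite /L1 /wlaw; apply: le_lt_trans fin0.
  apply: ge0_subset_integral => //.
  - apply: measurableI => //; rewrite -[X in measurable X]setTI.
    exact: (mX1 measurableT _ mA).
  - exact/measurable_EFinP.
have := @measure_unique _ R _ (@RGenInftyO.G R) (fun n => `]-oo, n%:R[%classic).
move=> /(_ _ _ _ _ (wlaw m1 mD1 mX1 mf1 p1) (wlaw m2 mD2 mX2 mf2 p2)) H; apply: H => //.
- exact: RGenInftyO.measurableE.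
- move=> A B [a ->] [b ->]; exists (Num.min a b).
  by apply/seteqP; split => x /=; rewrite !in_itv/= lt_min => /andP.
- by move=> n; exists n%:R.
- apply/seteqP; split => // x _; exists (Num.truncn x).+1 => //=; rewrite in_itv/=.
  exact: truncnS_gt.
- by move=> A [a ->]; exact: ray.
- by move=> n; apply: fin1; exact: measurable_itv.
Qed.

(** * Moments of a diagonal entry of a rotation invariant random projection *)

(** The difference has the distinct roots 0, 1, 2, ..., more than its size allows unless it is
    zero. *)
Lemma poly_eq_fun (R : realFieldType) (p q : {poly R}) : (forall x, p.[x] = q.[x]) -> p = q.
Proof.
move=> pq; apply/eqP; rewrite -subr_eq0; apply/eqP.
apply: (@roots_geq_poly_eq0 _ _ [seq i%:R | i <- iota 0 (size (p - q))]).
- by apply/allP => x _; rewrite /root !hornerE pq subrr.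
- rewrite map_inj_uniq ?iota_uniq// => i j /eqP.
  by rewrite eqr_nat => /eqP.
- by rewrite size_map size_iota.
Qed.

Section quadratic_power.
Variables (R : comNzRingType) (al be de : R).

(** For a symmetric [W] this is (e_s + t e_a) W (e_s + t e_a)^T as a polynomial in t, with [al],
    [be], [de] the entries at (s, s), (s, a), (a, a). *)
Definition quadp : {poly R} := al%:P + (2 * be) *: 'X + de *: 'X^2.

Lemma coef_quadp i : quadp`_i = (i == 0)%:R * al + (i == 1)%:R * (2 * be) + (i == 2)%:R * de.
Proof.
by rewrite /quadp !coefD coefC !coefZ coefX coefXn; case: i => [|[|[|i]]] /=; ring.
Qed.

(** The coefficient of t^2 is the one wanted; the other two carry the induction. At j = 0 the
    truncated exponent [j.-1] is multiplied by j. *)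
Lemma coef_quadpX j : [/\ (quadp ^+ j.+1)`_0 = al ^+ j.+1,
  (quadp ^+ j.+1)`_1 = 2 * j.+1%:R * be * al ^+ j &
  (quadp ^+ j.+1)`_2 = j.+1%:R * (de * al ^+ j) + (2 * j%:R * j.+1%:R) * (be ^+ 2 * al ^+ j.-1)].
Proof.
elim: j => [|j [h0 h1 h2]]; first by rewrite expr1 !coef_quadp /=; split; ring.
rewrite exprSr !coefM !big_ord_recr !big_ord0 /= !coef_quadp /= h0 h1 h2.
split; first by rewrite !exprS; ring.
  by rewrite -[j.+2%:R]natr1 !exprS; ring.
rewrite -[j.+2%:R]natr1 -[j.+1%:R]natr1.
case: j {h0 h1 h2} => [|j] /=; rewrite ?exprS; ring.
Qed.

Lemma horner_quadp t : quadp.[t] = al + 2 * be * t + de * t ^+ 2.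
Proof. by rewrite /quadp !hornerD hornerC !hornerZ hornerX hornerXn. Qed.

Lemma size_quadp : (size quadp <= 3)%N.
Proof.
rewrite /quadp (leq_trans (size_polyD _ _))// geq_max; apply/andP; split.
  rewrite (leq_trans (size_polyD _ _))// geq_max (leq_trans (size_polyC_leq1 _))//.
  by rewrite (leq_trans (size_scale_leq _ _))// size_polyX.
by rewrite (leq_trans (size_scale_leq _ _))// size_polyXn.
Qed.

Lemma size_quadpX j : (size (quadp ^+ j) <= (2 * j).+1)%N.
Proof.
apply: (leq_trans (size_poly_exp_leq _ _)).
rewrite ltnS leq_mul2r; apply/orP; right.
by have := size_quadp; case: (size quadp).
Qed.

End quadratic_power.

Section bounded_expectation.
Context d (T : measurableType d) (R : realType) (P : probability T R).

(** Bounded measurable functions form an algebra and are integrable for a probability; all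
    expectations of moments stay in this class. *)
Definition bmeas (f : T -> R) := measurable_fun setT f /\ exists C, forall x, `|f x| <= C.

Lemma bmeas_cst c : bmeas (fun=> c).
Proof. by split; [exact: measurable_cst|exists `|c|]. Qed.

Lemma bmeasD f g : bmeas f -> bmeas g -> bmeas (fun x => f x + g x).
Proof.
move=> [mf [A hA]] [mg [B hB]]; split; first exact: measurable_funD.
by exists (A + B) => x; rewrite (le_trans (ler_normD _ _))// lerD.
Qed.

Lemma bmeasM f g : bmeas f -> bmeas g -> bmeas (fun x => f x * g x).
Proof.
move=> [mf [A hA]] [mg [B hB]]; split; first exact: measurable_funM.
by exists (A * B) => x; rewrite normrM ler_pM.
Qed.

Lemma bmeasX f n : bmeas f -> bmeas (fun x => f x ^+ n).
Proof.
move=> bf; elim: n => [|n IH]; first exact: bmeas_cst.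
by under eq_fun do rewrite exprS; exact: bmeasM.
Qed.

Lemma bmeas_sum (I : Type) (r : seq I) (Q : pred I) (F : I -> T -> R) :
  (forall i, bmeas (F i)) -> bmeas (fun x => \sum_(i <- r | Q i) F i x).
Proof.
move=> bF; elim: r => [|i r IH]; first by under eq_fun do rewrite big_nil; exact: bmeas_cst.
under eq_fun do rewrite big_cons; case: (Q i) => //.
exact: bmeasD.
Qed.

Lemma bmeas_integrable f : bmeas f -> P.-integrable setT (EFin \o f).
Proof.
move=> [mf [C hC]]; apply: measurable_bounded_integrable => //.
  exact: (le_lt_trans (probability_le1 P measurableT) (ltry 1)).
exists C; split; first by rewrite num_real.
by move=> M CM x _; apply: (le_trans (hC x)); exact: ltW.
Qed.

Definition Ex (f : T -> R) : R := (\int[P]_x f x)%R.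

Lemma ExD f g : bmeas f -> bmeas g -> Ex (fun x => f x + g x) = Ex f + Ex g.
Proof. by move=> bf bg; apply: RintegralD => //; exact: bmeas_integrable. Qed.

Lemma ExZ c f : bmeas f -> Ex (fun x => c * f x) = c * Ex f.
Proof. by move=> bf; apply: RintegralZl => //; exact: bmeas_integrable. Qed.

Lemma Ex_cst c : Ex (fun=> c) = c.
Proof. by rewrite /Ex Rintegral_cst//= probability_setT mulr1. Qed.

Lemma Ex_sum (I : Type) (r : seq I) (Q : pred I) (F : I -> T -> R) :
  (forall i, bmeas (F i)) -> Ex (fun x => \sum_(i <- r | Q i) F i x) = \sum_(i <- r | Q i) Ex (F i).
Proof.
move=> bF; elim: r => [|i r IH].
  by rewrite big_nil; under [X in Ex X]eq_fun do rewrite big_nil; exact: Ex_cst.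
under [X in Ex X]eq_fun do rewrite big_cons; rewrite big_cons; case: (Q i) => //.
by rewrite ExD// ?IH//; exact: bmeas_sum.
Qed.

Lemma Ex_ae f g (G : set T) : bmeas f -> bmeas g -> measurable G -> P G = 1%E ->
  (forall x, G x -> f x = g x) -> Ex f = Ex g.
Proof.
move=> bf bg mG PG fg; rewrite /Ex /Rintegral; congr fine.
apply: ae_eq_integral => //; [by apply/measurable_EFinP; case: bf|by apply/measurable_EFinP; case: bg|].
exists (~` G); split; first exact: measurableC.
  by apply: etrans (probability_setC P mG) _; rewrite PG subee.
by move=> x /= h Gx; apply: h => _; rewrite fg.
Qed.

Lemma Ex_EFin f : bmeas f -> (\int[P]_x (f x)%:E)%E = (Ex f)%:E.
Proof.
move=> bf; rewrite /Ex /Rintegral fineK//.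
by apply: integrable_fin_num => //; exact: bmeas_integrable.
Qed.

Definition pbmeas (p : T -> {poly R}) := forall i, bmeas (fun x => (p x)`_i).

Lemma pbmeasX (p : T -> {poly R}) n : pbmeas p -> pbmeas (fun x => p x ^+ n).
Proof.
move=> bp; elim: n => [|n IH] i.
  by under eq_fun do rewrite expr0 coef1; exact: bmeas_cst.
under eq_fun do rewrite exprS coefM.
by apply: bmeas_sum => k; exact: bmeasM.
Qed.

(** The uniform bound on the degree makes the expectation itself a polynomial in t, whose
    coefficients can then be compared. *)
Lemma Ex_horner (p : T -> {poly R}) n t : pbmeas p -> (forall x, (size (p x) <= n)%N) ->
  Ex (fun x => (p x).[t]) = (\poly_(i < n) Ex (fun x => (p x)`_i)).[t].
Proof.
move=> bp sp; rewrite horner_poly.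
under [X in Ex X]eq_fun => x do rewrite (horner_coef_wide _ (sp x)).
rewrite Ex_sum; last by move=> i; apply: bmeasM => //; exact: bmeas_cst.
apply: eq_bigr => i _; under [X in Ex X]eq_fun do rewrite mulrC.
by rewrite ExZ// mulrC.
Qed.

Variables (n : nat) (W : T -> 'M[R]_n).
Hypotheses (mW : mxmeas W) (sW : forall x, sidem (W x)).

Lemma sidem_diag x i : W x i i = \sum_j W x i j ^+ 2.
Proof.
have [WT WW] := sW x; rewrite -{1}WW mxE; apply: eq_bigr => j _.
by rewrite expr2 -{2}WT mxE.
Qed.

Lemma sidem_entry_le x i j : W x i j ^+ 2 <= W x i i.
Proof.
by rewrite sidem_diag (bigD1 j)//= lerDl sumr_ge0// => k _; rewrite sqr_ge0.
Qed.

Lemma sidem_diag01 x i : 0 <= W x i i <= 1.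
Proof.
have := sidem_entry_le x i i; have := sqr_ge0 (W x i i).
by move=> h1 h2; apply/andP; split; [lra|nra].
Qed.

Lemma bmeas_entry i j : bmeas (fun x => W x i j).
Proof.
split; first exact: mW.
exists 1 => x; have := sidem_entry_le x i j; have /andP[_ h] := sidem_diag01 x i.
by move=> h2; rewrite -(@expr_le1 _ 2)// real_normK ?num_real// (le_trans h2).
Qed.

Variables (s : 'I_n) (J : {set 'I_n}) (k : nat).
Hypotheses (sJ : s \in J) (WJ : forall x i j, i \notin J -> W x i j = 0).
Hypothesis Wk : P [set x | \tr (W x) = k%:R] = 1%E.
Hypothesis Winv : forall a j c c', a \in J -> a != s -> c ^+ 2 + c' ^+ 2 = 1 ->
  Ex (fun x => (c ^+ 2 * W x s s + 2 * c * c' * W x s a + c' ^+ 2 * W x a a) ^+ j) =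
  Ex (fun x => W x s s ^+ j).

Let c_ j := Ex (fun x => W x s s ^+ j).

(** Homogeneity extends [Winv] from unit vectors to e_s + t e_a. The right side becomes a multiple
    of a power of [quadp 1 0 1], the squared length 1 + t^2, whose power j + 1 has t^2 coefficient j
    + 1. *)
Lemma moment_rotation a j : a \in J -> a != s ->
  Ex (fun x => j.+1%:R * (W x a a * W x s s ^+ j)
        + (2 * j%:R * j.+1%:R) * (W x s a ^+ 2 * W x s s ^+ j.-1)) = j.+1%:R * c_ j.+1.
Proof.
move=> aJ as_.
pose p x := quadp (W x s s) (W x s a) (W x a a) ^+ j.+1.
have bp : pbmeas p.
  apply: pbmeasX => i; under eq_fun do rewrite coef_quadp.
  apply: bmeasD; first apply: bmeasD.
  - by apply: bmeasM; [exact: bmeas_cst|exact: bmeas_entry].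
  - apply: bmeasM; first exact: bmeas_cst.
    by apply: bmeasM; [exact: bmeas_cst|exact: bmeas_entry].
  - by apply: bmeasM; [exact: bmeas_cst|exact: bmeas_entry].
have sp x : (size (p x) <= (2 * j.+1).+1)%N by exact: size_quadpX.
have E : \poly_(i < (2 * j.+1).+1) Ex (fun x => (p x)`_i) = c_ j.+1 *: quadp 1 0 1 ^+ j.+1.
  apply: poly_eq_fun => t; rewrite -Ex_horner//.
  (* u and t u are the coordinates of e_s + t e_a after normalisation, the cosine and sine given to
     [Winv]. *)
  pose u := (Num.sqrt (1 + t ^+ 2))^-1.
  have t0 : 0 < 1 + t ^+ 2 by rewrite ltr_pwDl// sqr_ge0.
  have u2 : u ^+ 2 * (1 + t ^+ 2) = 1 by rewrite exprVn sqr_sqrtr ?ltW// mulVf// gt_eqF.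
  have uu : u ^+ 2 + (t * u) ^+ 2 = 1 by rewrite -u2; ring.
  have := Winv j.+1 aJ as_ uu; rewrite -/(c_ j.+1) => <-.
  rewrite hornerZ mulrC -ExZ; last first.
    apply: bmeasX; apply: bmeasD; first apply: bmeasD.
    - by apply: bmeasM; [exact: bmeas_cst|exact: bmeas_entry].
    - by apply: bmeasM; [exact: bmeas_cst|exact: bmeas_entry].
    - by apply: bmeasM; [exact: bmeas_cst|exact: bmeas_entry].
  congr Ex; apply/funext => x; rewrite /p !horner_exp -exprMn; congr (_ ^+ _).
  rewrite !horner_quadp.
  transitivity ((u ^+ 2 * (1 + t ^+ 2)) * (W x s s + 2 * W x s a * t + W x a a * t ^+ 2)).
    by rewrite u2; ring.
  by ring.
have := congr1 (fun q : {poly R} => q`_2) E.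
rewrite coef_poly coefZ.
have -> : (2 < (2 * j.+1).+1)%N by rewrite ltnS mulnS leq_addr.
have [_ _ ->] := coef_quadpX (1 : R) 0 1 j.
rewrite !expr1n expr0n mul0r mulr0 addr0 !mulr1 mulrC => <-.
by congr Ex; apply/funext => x; have [_ _ ->] := coef_quadpX (W x s s) (W x s a) (W x a a) j.
Qed.

(** [J] holds the coordinates where [W] may be nonzero, so its cardinal is the ambient dimension. In
    the sum over the a in J other than s, the W_aa add up to tr W - W_ss, and by idempotence the
    W_sa^2 add up to W_ss - W_ss^2; the common factor j + 1 is cancelled at the end. *)
Lemma moment_rec j : (#|J| + 2 * j)%:R * c_ j.+1 = (k + 2 * j)%:R * c_ j.
Proof.
pose f a x := j.+1%:R * (W x a a * W x s s ^+ j)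
        + (2 * j%:R * j.+1%:R) * (W x s a ^+ 2 * W x s s ^+ j.-1).
have bs : bmeas (fun x => W x s s) by exact: bmeas_entry.
have bf a : bmeas (f a).
  apply: bmeasD; apply: bmeasM; try exact: bmeas_cst.
    by apply: bmeasM; [exact: bmeas_entry|exact: bmeasX].
  by apply: bmeasM; apply: bmeasX => //; exact: bmeas_entry.
have h1 : Ex (fun x => \sum_(a in J :\ s) f a x) = (#|J|%:R - 1) * (j.+1%:R * c_ j.+1).
  rewrite Ex_sum// (eq_bigr (fun=> j.+1%:R * c_ j.+1)); last first.
    by move=> a; rewrite !inE => /andP[as_ aJ]; exact: moment_rotation.
  by rewrite sumr_const (cardsD1 s J) sJ natrD /= addrAC subrr add0r -[LHS]mulr_natl.
pose g x := j.+1%:R * (\tr (W x) * W x s s ^+ j) + (- j.+1%:R) * W x s s ^+ j.+1 +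
  (2 * j%:R * j.+1%:R) * (W x s s ^+ j) + (- (2 * j%:R * j.+1%:R)) * W x s s ^+ j.+1.
have fg x : \sum_(a in J :\ s) f a x = g x.
  rewrite big_split /= -!mulr_sumr -!mulr_suml.
  have -> : \sum_(a in J :\ s) W x a a = \tr (W x) - W x s s.
    have -> : \tr (W x) = \sum_(a in J) W x a a.
      by rewrite /mxtrace (bigID (mem J))/= [X in _ + X]big1 ?addr0// => i; exact: WJ.
    by rewrite (big_setD1 s sJ) /= addrAC subrr add0r.
  have -> : \sum_(a in J :\ s) W x s a ^+ 2 = W x s s - W x s s ^+ 2.
    have -> : W x s s - W x s s ^+ 2 = \sum_(a in J) W x s a ^+ 2 - W x s s ^+ 2.
      rewrite {1}sidem_diag (bigID (mem J))/= [X in _ + X - _]big1 ?addr0// => i iJ.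
      by have [<- _] := sW x; rewrite mxE WJ// expr0n.
    by rewrite (big_setD1 s sJ) /= addrAC subrr add0r.
  by rewrite /g; case: (j) => [|j'] /=; rewrite ?exprS; ring.
have bt : bmeas (fun x => \tr (W x)) by apply: bmeas_sum => i; exact: bmeas_entry.
have bX i : bmeas (fun x => W x s s ^+ i) by exact: bmeasX.
have bZ c i : bmeas (fun x => c * W x s s ^+ i) by apply: bmeasM => //; exact: bmeas_cst.
have bT : bmeas (fun x => \tr (W x) * W x s s ^+ j) by exact: bmeasM.
have bTZ : bmeas (fun x => j.+1%:R * (\tr (W x) * W x s s ^+ j)).
  by apply: bmeasM => //; exact: bmeas_cst.
have h2 : Ex g = j.+1%:R * (k%:R * c_ j) - j.+1%:R * c_ j.+1 +
    (2 * j%:R * j.+1%:R) * c_ j - (2 * j%:R * j.+1%:R) * c_ j.+1.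
  rewrite /g ExD//; last by do 2 (apply: bmeasD => //).
  rewrite ExD//; last by apply: bmeasD.
  rewrite ExD// !ExZ// !mulNr; congr (_ * _ - _ + _ - _).
  rewrite (@Ex_ae _ (fun x => k%:R * W x s s ^+ j) [set x | \tr (W x) = k%:R])//.
  - exact: ExZ.
  - have -> : [set x | \tr (W x) = k%:R] = [set x | \tr (W x) - k%:R = 0].
      by apply/seteqP; split => x /= => [->|/eqP]; rewrite ?subrr// subr_eq0 => /eqP.
    by apply: measurable_eq0; apply: measurable_funB; [case: bt|exact: measurable_cst].
  - by move=> x /= ->.
have E : Ex (fun x => \sum_(a in J :\ s) f a x) = Ex g by congr Ex; apply/funext.
move: E; rewrite h1 h2 => E.
have j0 : j.+1%:R != 0 :> R by rewrite pnatr_eq0.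
have e1 m : (m + 2 * j)%:R = m%:R + 2 * j%:R :> R by rewrite natrD natrM.
apply: (mulfI j0); rewrite !e1.
move: E; set a := c_ j.+1; set b := c_ j => E; lra.
Qed.

End bounded_expectation.

(** * Successive coordinate sections of a subspace *)

(** Indexed by a natural number so that [cutn] can recurse on it; for i >= n the column is 0 and the
    cut changes nothing. *)
Definition ecol (R : realType) n (i : nat) : 'cV[R]_n := \col_j ((j : nat) == i)%:R.

Fixpoint cutn (R : realType) n (P : 'M[R]_n) (s : nat) : 'M[R]_n :=
  if s is i.+1 then cutP (cutn P i) (ecol R n i) else P.

Section cutn.
Variables (R : realType) (n : nat).
Implicit Types (P U W : 'M[R]_n).

Lemma ecolE (i : 'I_n) : ecol R n i = delta_mx i 0.
Proof. by apply/colP => j; rewrite !mxE eqxx andbT. Qed.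

Lemma mul_ecol m (A : 'M[R]_(m, n)) (i : 'I_n) : A *m ecol R n i = col i A.
Proof. by rewrite ecolE -colE. Qed.

Lemma ecol_mul m (A : 'M[R]_(n, m)) (i : 'I_n) : (ecol R n i)^T *m A = row i A.
Proof. by rewrite ecolE trmx_delta -rowE. Qed.

Lemma ecol_quad W (i : 'I_n) : ((ecol R n i)^T *m W *m ecol R n i) 0 0 = W i i.
Proof. by rewrite ecol_mul mul_ecol !mxE. Qed.

Lemma cutn_sidem P s : sidem P -> sidem (cutn P s).
Proof. by move=> sP; elim: s => //= s IH; exact: cutP_sidem. Qed.

Lemma cutn_fix P s (x : 'rV[R]_n) : sidem P ->
  x *m cutn P s = x <-> (x *m P = x /\ forall i : 'I_n, (i < s)%N -> x 0 i = 0).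
Proof.
move=> sP; elim: s => [|s IH] /=; first by split=> [|[]].
rewrite cutP_fix; last exact: cutn_sidem.
rewrite IH; split=> [[[h1 h2] h3]|[h1 h2]].
  split=> // i; rewrite ltnS leq_eqVlt => /orP[/eqP is_|]; last exact: h2.
  by move: h3; rewrite -is_ mul_ecol mxE.
split; first by split=> // i /ltnW; exact: h2.
have [sn|sn] := ltnP s n.
  by rewrite (_ : s = Ordinal sn)// mul_ecol mxE h2.
rewrite (_ : ecol R n s = 0) ?mulmx0 ?mxE//.
by apply/colP => j; rewrite !mxE ltn_eqF// (leq_trans (ltn_ord j)).
Qed.

(** The rows of a projection are fixed by it, so they lie in the section and their first s
    coordinates vanish; symmetry exchanges rows and columns. *)
Lemma cutn_row0 P s (i j : 'I_n) : sidem P -> (i < s)%N -> cutn P s i j = 0.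
Proof.
move=> sP is_; have [WT WW] := cutn_sidem s sP.
have : row j (cutn P s) *m cutn P s = row j (cutn P s) by rewrite -row_mul WW.
by move=> /(cutn_fix s _ sP)[_ /(_ i is_)]; rewrite mxE -{1}WT mxE.
Qed.

Lemma cutn_tr P (s : 'I_n) : sidem P ->
  \tr (cutn P s.+1) = \tr (cutn P s) - (cutn P s s s != 0)%:R.
Proof. by move=> sP; rewrite /= cutP_tr ?ecol_quad//; exact: cutn_sidem. Qed.

(** An orthogonal [U] that fixes [a] preserves the hyperplane orthogonal to [a]. *)
Lemma cutP_rot W U (a : 'cV[R]_n) : U *m U^T = 1%:M -> a^T *m U = a^T ->
  cutP (U^T *m W *m U) a = U^T *m cutP W a *m U.
Proof.
move=> UU aU; have aU' : a^T *m U^T = a^T by rewrite -{1}aU -mulmxA UU mulmx1.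
have Ua : U *m a = a by apply: trmx_inj; rewrite trmx_mul.
have E : a^T *m (U^T *m W *m U) = a^T *m W *m U by rewrite !mulmxA aU'.
rewrite /cutP E -(mulmxA _ U a) Ua mulmxBr mulmxBl -scalemxAr -scalemxAl; congr (_ - _ *: _).
by rewrite trmx_mul !mulmxA.
Qed.

Lemma cutn_rot P U s : U *m U^T = 1%:M ->
  (forall i : 'I_n, (i < s)%N -> row i U = (ecol R n i)^T) ->
  cutn (U^T *m P *m U) s = U^T *m cutn P s *m U.
Proof.
move=> UU; elim: s => //= s IH hU; rewrite IH; last by move=> i /ltnW; exact: hU.
apply: cutP_rot => //.
have [sn|sn] := ltnP s n.
  by rewrite (_ : s = Ordinal sn)// ecol_mul hU.
rewrite (_ : ecol R n s = 0) ?trmx0 ?mul0mx//.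
by apply/colP => j; rewrite !mxE ltn_eqF// (leq_trans (ltn_ord j)).
Qed.

End cutn.

(** * Plane rotations *)

Section givens.
Variables (R : realType) (n : nat) (s a : 'I_n).
Hypothesis sa : a != s.

Let D : 'M[R]_n := delta_mx s s + delta_mx a a.
Let K : 'M[R]_n := delta_mx s a - delta_mx a s.

(** On the plane of e_s and e_a, [D] is the identity and [K] a quarter turn, so they multiply like 1
    and i, and [givensM] is the product of the complex numbers c + i c' and e + i e'. *)
Definition givens (c c' : R) : 'M[R]_n := 1%:M + (c - 1) *: D + c' *: K.

Let as_ : s != a. Proof. by rewrite eq_sym. Qed.

Let DD : D *m D = D.
Proof. by rewrite /D mulmxDl !mulmxDr !mul_delta_mx !mul_delta_mx_0// addr0 add0r. Qed.
Let DK : D *m K = K.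
Proof. by rewrite /D /K mulmxDl !mulmxBr !mul_delta_mx !mul_delta_mx_0// subr0 sub0r. Qed.
Let KD : K *m D = K.
Proof. by rewrite /D /K mulmxBl !mulmxDr !mul_delta_mx !mul_delta_mx_0// addr0 add0r. Qed.
Let KK : K *m K = - D.
Proof. by rewrite /D /K mulmxBl !mulmxBr !mul_delta_mx !mul_delta_mx_0// subr0 sub0r opprD. Qed.

Lemma givensM c c' e e' : givens c c' *m givens e e' = givens (c * e - c' * e') (c * e' + c' * e).
Proof.
rewrite /givens !mulmxDl !mulmxDr !mul1mx !mulmx1 -!scalemxAl -!scalemxAr DD DK KD KK.
by apply/matrixP => i j; rewrite !mxE; ring.
Qed.

Lemma givens_tr c c' : (givens c c')^T = givens c (- c').
Proof.
rewrite /givens /D /K; apply/matrixP => i j; rewrite !mxE.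
by rewrite (eq_sym j i) (andbC (j == s)) (andbC (j == a)) (andbC (j == s)) (andbC (j == a)); ring.
Qed.

Lemma givens1 : givens 1 0 = 1%:M.
Proof. by rewrite /givens subrr !scale0r !addr0. Qed.

Lemma givens_orth c c' : c ^+ 2 + c' ^+ 2 = 1 -> givens c c' *m (givens c c')^T = 1%:M.
Proof.
move=> h; rewrite givens_tr givensM -givens1; congr givens; last by ring.
by rewrite -h; ring.
Qed.

(* A rotation is the square of the rotation by half its angle. *)
Lemma givens_rotation c c' : c ^+ 2 + c' ^+ 2 = 1 -> rotation (givens c c').
Proof.
move=> h; split; first exact: givens_orth.
have [e [e' [he -> ->]]] : exists e e' : R, [/\ e ^+ 2 + e' ^+ 2 = 1, c = e * e - e' * e' & c' = e * e' + e' * e].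
  (* The half turn is treated apart: there the cosine e of the half angle is 0, and the formula for
     the sine divides by e. *)
  have [c1|c1] := eqVneq c (-1).
    exists 0, 1; rewrite c1; split; [ring|ring|].
    by move: h; rewrite c1 sqrrN expr1n => /eqP; rewrite -subr_eq0 addrAC subrr add0r sqrf_eq0 => /eqP ->; ring.
  have cm : 0 < 1 + c.
    by rewrite lt_def; apply/andP; split; [rewrite addrC addr_eq0|have := sqr_ge0 c'; nra].
  pose e := Num.sqrt ((1 + c) / 2).
  have e0 : 0 < e by rewrite sqrtr_gt0 divr_gt0.
  have e2 : e ^+ 2 = (1 + c) / 2 by rewrite sqr_sqrtr// ltW// divr_gt0.
  exists e, (c' / (2 * e)).
  have E' : (c' / (2 * e)) ^+ 2 = (1 - c) / 2.
    have -> : (c' / (2 * e)) ^+ 2 = c' ^+ 2 / (4 * e ^+ 2) by field; rewrite gt_eqF.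
    have -> : c' ^+ 2 = (1 - c) * (1 + c) by rewrite -[X in _ = (X - _) * _]h -h; nra.
    by rewrite e2; field; rewrite gt_eqF.
  split; first by rewrite E' e2; field.
    by rewrite -!expr2 E' e2; field.
  by field; rewrite gt_eqF.
rewrite -givensM det_mulmx.
have := congr1 determinant (givens_orth he).
by rewrite det_mulmx det_tr det1.
Qed.

Lemma givens_row c c' : row s (givens c c') = c *: (ecol R n s)^T + c' *: (ecol R n a)^T.
Proof.
rewrite /givens /D /K; apply/rowP => j; rewrite !mxE eqxx (eq_sym s a) (negbTE sa) /=.
by rewrite -!val_eqE /= (eq_sym (s : nat)); ring.
Qed.

Lemma givens_row_other c c' (i : 'I_n) : i != s -> i != a -> row i (givens c c') = (ecol R n i)^T.
Proof.
move=> is_ ia; rewrite /givens /D /K; apply/rowP => j; rewrite !mxE (negbTE is_) (negbTE ia) /=.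
by rewrite -!val_eqE /= (eq_sym (i : nat)); ring.
Qed.

Lemma givens_quad c c' (W : 'M[R]_n) : W^T = W ->
  (givens c c' *m W *m (givens c c')^T) s s =
  c ^+ 2 * W s s + 2 * c * c' * W s a + c' ^+ 2 * W a a.
Proof.
move=> WT; set V := givens c c'.
have -> : (V *m W *m V^T) s s = (row s V *m W *m (row s V)^T) 0 0.
  by rewrite -row_mul tr_row !mxE; apply: eq_bigr => k _; rewrite !mxE.
rewrite givens_row linearD/= !linearZ/= !trmxK mulmxDl -!scalemxAl !ecol_mul.
rewrite mulmxDr !mulmxDl -!scalemxAl -!scalemxAr !mul_ecol !mxE.
have -> : W a s = W s a by rewrite -[in LHS]WT mxE.
by ring.
Qed.

End givens.

(** * Law of the diagonal entries of the sections *)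

Section radial_density.
Variable R : realType.

(** The density of the distance r for a section of dimension [k] and codimension [dd]; under it r^-2
    has the beta law with parameters k/2 and dd/2. *)
Definition rdens (k dd : nat) (r : R) : R :=
  omega R k * omega R dd / omega R (k + dd) * phi k.+1 (dd%:R / 2 - 1) r.

Lemma rdens_cst_ge0 k dd : (0 < k)%N -> (0 < dd)%N ->
  0 <= omega R k * omega R dd / omega R (k + dd).
Proof.
move=> k0 dd0; apply: divr_ge0; first apply: mulr_ge0; apply/ltW/omega_gt0 => //.
by rewrite addn_gt0 k0.
Qed.

(** The factor r^(-2j) only raises the exponent, so the moments of r^-2 are again values of
    [radint]. *)
Lemma rdens_moment k dd j : (0 < k)%N -> (0 < dd)%N ->
  (\int[lebesgue_measure]_(r in `]1%R, +oo[) (r^-1 ^+ 2 ^+ j * rdens k dd r)%:E =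
   (omega R k * omega R dd / omega R (k + dd))%:E * @radint R (k + 2 * j) dd)%E.
Proof.
move=> k0 dd0; rewrite /radint -ge0_integralZl_EFin//; first last.
- exact: rdens_cst_ge0.
- exact: phi_measurable.
- exact: phi_ge0E.
apply: eq_integral => r _; rewrite -EFinM /rdens /phi; congr (_%:E).
by rewrite -exprM -[in RHS]addSn exprD; ring.
Qed.

Lemma rdens_integrable k dd : (0 < k)%N -> (0 < dd)%N ->
  lebesgue_measure.-integrable `]1%R, +oo[ (EFin \o rdens k dd).
Proof.
move=> k0 dd0.
have c0 := rdens_cst_ge0 k0 dd0.
apply/integrableP; split.
  apply/measurable_EFinP; apply: measurable_funM => //.
  by apply/measurable_EFinP; exact: phi_measurable.
have E : (\int[lebesgue_measure]_(r in `]1%R, +oo[) `|(rdens k dd r)%:E| =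
   \int[lebesgue_measure]_(r in `]1%R, +oo[) (r^-1 ^+ 2 ^+ 0 * rdens k dd r)%:E)%E.
  apply: eq_integral => r; rewrite inE/= in_itv/= andbT => r1.
  by rewrite expr0 mul1r ger0_norm// mulr_ge0// phi_ge0.
by rewrite [ltLHS]E rdens_moment// muln0 addn0 radintE// -EFinM ltry.
Qed.

Lemma rdens_ge0 k dd r : (0 < k)%N -> (0 < dd)%N -> `]1%R, +oo[%classic r -> 0 <= rdens k dd r.
Proof.
by move=> k0 dd0; rewrite /= in_itv/= andbT => r1; rewrite mulr_ge0 ?phi_ge0// rdens_cst_ge0.
Qed.

End radial_density.

Lemma prob1I d (T : measurableType d) (R : realType) (P : probability T R) (A B : set T) :
  measurable A -> measurable B -> P A = 1%E -> P B = 1%E -> P (A `&` B) = 1%E.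
Proof.
move=> mA mB PA PB.
have PA' : P (~` A) = 0%E by apply: etrans (probability_setC P mA) _; rewrite PA subee.
have PB' : P (~` B) = 0%E by apply: etrans (probability_setC P mB) _; rewrite PB subee.
have mU : measurable (~` A `|` ~` B) by apply: measurableU; exact: measurableC.
have PU : P (~` A `|` ~` B) = 0%E.
  by apply: etrans PA'; apply: measureU0 => //; exact: measurableC.
rewrite -[A `&` B]setCK setCI.
by apply: etrans (probability_setC P mU) _; rewrite PU sube0.
Qed.

Lemma prob_eq1 d (T : measurableType d) (R : realType) (P : probability T R) (A B G : set T) :
  measurable A -> measurable B -> measurable G -> P G = 1%E ->
  (forall x, G x -> (A x <-> B x)) -> P A = P B.
Proof.
move=> mA mB mG PG AB.
have PG' : P (~` G) = 0%E by apply: etrans (probability_setC P mG) _; rewrite PG subee.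
have h X : measurable X -> P X = P (X `&` G).
  move=> mX; have mXG : measurable (X `&` ~` G) by apply: measurableI => //; exact: measurableC.
  rewrite -[in LHS](setIT X) -(setUv G) setIUr; apply: measureU0 => //; first exact: measurableI.
  apply/eqP; rewrite eq_le measure_ge0 andbT -PG'.
  by apply: le_measure; rewrite ?inE//; exact: measurableC.
rewrite (h A)// (h B)//; congr (P _).
by apply/seteqP; split => x [h1 h2]; split=> //; apply/(AB _ h2).
Qed.

Lemma mxmeas_cutn (R : realType) n s : mxmeas (fun P : GrT R n => cutn (P : 'M[R]_n) s).
Proof.
elim: s => [|s IH] /=; first exact: mxmeas_GrT.
by apply: mxmeas_cutP => //; exact: mxmeas_cst.
Qed.

Section section_law.
Variables (R : realType) (n q : nat).
Hypotheses (hq1 : (1 <= q)%N) (hq2 : (q <= n - 1)%N).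
Variable nu : probability (GrT R n) R.
Hypothesis nu_supp : nu [set P | is_orth_proj q P] = 1%E.
Hypothesis nu_inv : forall U : 'M[R]_n, rotation U ->
     forall A : set (GrT R n), measurable A -> nu (rotG U @^-1` A) = nu A.

Let G : set (GrT R n) := [set P | is_orth_proj q P].

Let mG : measurable G.
Proof. exact: (measurable_orth_proj q (@mxmeas_GrT R n)). Qed.

(* The sections of [L], replaced by [0] when the matrix is not an orthogonal projection of rank [q]. *)
Let W (s : nat) (P : GrT R n) : 'M[R]_n := (\1_G P : R) *: cutn (P : 'M[R]_n) s.

Let WG s P : G P -> W s P = cutn (P : 'M[R]_n) s.
Proof. by move=> GP; rewrite /W indicE mem_set// scale1r. Qed.

Let WnG s P : ~ G P -> W s P = 0.
Proof. by move=> GP; rewrite /W indicE memNset// scale0r. Qed.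

Let mW s : mxmeas (W s).
Proof. by apply: mxmeas_scale; [exact: measurable_indic|exact: mxmeas_cutn]. Qed.

Let sW s P : sidem (W s P).
Proof.
have [GP|GP] := pselect (G P).
  by rewrite WG//; apply: cutn_sidem; have /sidem_orth_proj[] := GP.
by rewrite WnG//; split; rewrite ?trmx0 ?mul0mx.
Qed.

Let WJ (s i j : 'I_n) P : (i < s)%N -> W s P i j = 0.
Proof.
move=> is_; have [GP|GP] := pselect (G P); last by rewrite WnG// mxE.
by rewrite WG// cutn_row0//; have /sidem_orth_proj[] := GP.
Qed.

Let rotG_G U (P : 'M[R]_n) : U *m U^T = 1%:M -> is_orth_proj q P -> is_orth_proj q (rotG U P).
Proof.
move=> UU /sidem_orth_proj[[PT PP] tP]; apply/sidem_orth_proj; rewrite /rotG; split; last first.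
  by rewrite mxtrace_mulC mulmxA UU mul1mx.
split; first by rewrite !trmx_mul trmxK PT mulmxA.
by rewrite !mulmxA -(mulmxA _ U) UU mulmx1 -(mulmxA _ P P) PP.
Qed.

Let W_rot s U P : U *m U^T = 1%:M ->
  (forall i : 'I_n, (i < s)%N -> row i U = (ecol R n i)^T) -> W s (rotG U P) = U^T *m W s P *m U.
Proof.
move=> UU hU; have [GP|GP] := pselect (G P).
  rewrite !WG//; last exact: rotG_G.
  exact: cutn_rot.
(* If the rotated matrix were a projection of rank q, rotating back by the transpose would make P
   one. *)
rewrite !WnG ?mulmx0 ?mul0mx// => H; apply: GP.
have UU' : U^T *m U = 1%:M by exact: mulmx1C.
have := @rotG_G U^T _ _ H; rewrite trmxK => /(_ UU').
rewrite /rotG trmxK !mulmxA UU mul1mx -mulmxA UU mulmx1.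
by [].
Qed.

Let Ex_rot (U : 'M[R]_n) (h : GrT R n -> R) : rotation U -> bmeas h ->
  Ex nu (h \o rotG U) = Ex nu h.
Proof.
move=> rU bh; rewrite /Ex /Rintegral; congr fine.
have mr := measurable_rotG U.
have mh : measurable_fun setT (EFin \o h) by apply/measurable_EFinP; case: bh.
have := @integral_pushforward _ _ (GrT R n) (GrT R n) R (rotG U) mr nu setT (EFin \o h) mh.
rewrite preimage_setT => <-//; last first.
  apply: (@bmeas_integrable _ _ _ nu (h \o rotG U)).
  case: bh => mh' [C hC]; split; first exact: (measurableT_comp mh' mr).
  by exists C => x; exact: hC.
apply: eq_measure_integral => A mA _; exact: nu_inv.
Qed.

Let d := (n - q)%N.
Let d0 : (0 < d)%N. Proof. rewrite /d; lia. Qed.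
Let qn : (q < n)%N. Proof. lia. Qed.

(** Both sides are 1 at j = 0 and obey the same first order recurrence, by [moment_rec] on the left
    and [radint_k] on the right. *)
Let alpha_moment (s : 'I_n) : (s < q)%N ->
  nu [set P | \tr (W s P) = (q - s)%:R] = 1%E ->
  forall j, (Ex nu (fun P => W s P s s ^+ j))%:E =
   ((omega R (q - s) * omega R d / omega R (q - s + d))%:E * @radint R (q - s + 2 * j) d)%E.
Proof.
move=> sq tr1.
have k0 : (0 < q - s)%N by rewrite subn_gt0.
pose J : {set 'I_n} := finset (fun i : 'I_n => (s <= i)%N).
have cJ : #|J| = (q - s + d)%N.
  have h1 : #|[pred i : 'I_n | (i < s)%N]| = s.
    rewrite -sum1_card (eq_bigl (fun i : 'I_n => (i < s)%N))//.
    by rewrite -(big_ord_widen n (fun=> 1%N) (ltnW (ltn_ord s))) sum1_card card_ord.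
  have h2 : (s + #|J|)%N = n.
    rewrite -[RHS]card_ord -(cardC [pred i : 'I_n | (i < s)%N]) h1; congr (_ + _)%N.
    by apply: eq_card => i; rewrite !inE -leqNgt.
  rewrite /d; lia.
have sJ : s \in J by rewrite inE.
have WJ' P (i j : 'I_n) : i \notin J -> W s P i j = 0.
  by rewrite inE -ltnNge; exact: WJ.
have Winv a j c c' : a \in J -> a != s -> c ^+ 2 + c' ^+ 2 = 1 ->
  Ex nu (fun x => (c ^+ 2 * W s x s s + 2 * c * c' * W s x s a + c' ^+ 2 * W s x a a) ^+ j) =
  Ex nu (fun x => W s x s s ^+ j).
  rewrite inE => sa as_ cc.
  (* [rotG] multiplies by the transpose on the left, so the angle is reversed to end with c' in
     [givens_quad]. *)
  have rU : rotation (givens s a c (- c')) by apply: givens_rotation => //; rewrite sqrrN.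
  rewrite -[RHS](Ex_rot rU); last by apply: bmeasX; exact: bmeas_entry.
  congr Ex; apply/funext => P /=; rewrite W_rot; last 2 first.
  - by case: rU.
  - move=> i is_; apply: givens_row_other; apply: contraTneq is_ => ->; first by rewrite ltnn.
    by rewrite -leqNgt.
  rewrite givens_tr opprK -[givens s a c (- c')]givens_tr.
  by rewrite givens_quad//; case: (sW s P).
have rec := moment_rec (mW s) (sW s) sJ WJ' tr1 Winv.
elim=> [|j IH].
  rewrite muln0 addn0 radintE// -EFinM; congr (_%:E).
  rewrite (_ : (fun P => _) = fun=> 1); last by apply/funext => P; rewrite expr0.
  have w m : (0 < m)%N -> omega R m != 0 by move=> /(omega_gt0 R) h; rewrite gt_eqF.
  have w1 := w _ k0; have w2 := w _ d0.
  have w3 : omega R (q - s + d) != 0 by apply: w; rewrite addn_gt0 k0.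
  rewrite Ex_cst; move: w1 w2 w3.
  move: (omega R (q - s)) (omega R d) (omega R (q - s + d)) => x y z x0 y0 z0.
  by rewrite mulrA divfK// divff// mulf_neq0.
have kj0 : (0 < q - s + 2 * j)%N by rewrite addn_gt0 k0.
have h := radint_k R kj0 d0.
have e1 : ((q - s + 2 * j).+2 = q - s + 2 * j.+1)%N by lia.
rewrite -e1; have := rec j; rewrite cJ => r1.
have nz : (q - s + d + 2 * j)%:R != 0 :> R by rewrite pnatr_eq0 -lt0n addn_gt0 addn_gt0 k0.
have : ((q - s + d + 2 * j)%:R%:E * (Ex nu (fun P => W s P s s ^+ j.+1))%:E =
  (q - s + d + 2 * j)%:R%:E * ((omega R (q - s) * omega R d / omega R (q - s + d))%:E * @radint R (q - s + 2 * j).+2 d))%E.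
  rewrite -EFinM r1 EFinM IH muleCA [in RHS]muleCA; congr (_ * _)%E.
  by rewrite addnAC.
move/(congr1 (mule ((q - s + d + 2 * j)%:R^-1)%:E)).
by rewrite -!EFinM mulKf// muleA -EFinM mulVf// mul1e.
Qed.

Let alpha_law (s : 'I_n) : (s < q)%N ->
  nu [set P | \tr (W s P) = (q - s)%:R] = 1%E ->
  forall C : set R, measurable C ->
  nu [set P | C (W s P s s)] =
  (\int[lebesgue_measure]_(r in `]1%R, +oo[ `&` [set r | C ((r^-1 ^+ 2)%R : R)]) (rdens (q - s) d r)%:E)%E.
Proof.
move=> sq tr1 C mC.
have k0 : (0 < q - s)%N by rewrite subn_gt0.
have bX : bmeas (fun P => W s P s s) by exact: bmeas_entry.
have mi : measurable_fun [set: R] (fun r : R => r^-1 ^+ 2).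
  by apply: measurable_funX; apply: measurable_fun_inv; exact: measurable_id.
have mr : measurable_fun `](1 : R), +oo[ (rdens (q - s) d : R -> R).
  by have /integrableP[/measurable_EFinP] := rdens_integrable R k0 d0.
have := @wlaw_moment_unique _ _ _ _ R nu setT (fun P => W s P s s) (cst 1) measurableT bX.1
  (measurable_cst _) (fun _ _ => ler01) lebesgue_measure `]1%R, +oo[%classic (fun r => r^-1 ^+ 2) (rdens (q - s) d)
  (measurable_itv _) mi mr (fun r => rdens_ge0 k0 d0) _ _ _ _ _ C mC.
rewrite setTI => H; rewrite -[RHS]H.
- have mA : measurable [set P | C (W s P s s)].
    by have := bX.1 measurableT _ mC; rewrite setTI.
  by rewrite -[LHS]mul1e -integral_cst.
- by move=> P _; apply: sidem_diag01; exact: sW.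
- move=> r; rewrite /= in_itv/= andbT => r1; have r0 : 0 < r by apply: lt_trans r1.
  by rewrite sqr_ge0 expr_le1// ?invr_ge0 ?ltW// invf_lt1.
- by apply: bmeas_integrable; exact: bmeas_cst.
- exact: rdens_integrable.
- move=> j; rewrite rdens_moment// -(alpha_moment sq tr1) -Ex_EFin; last exact: bmeasX.
  by apply: eq_integral => P _; rewrite mulr1.
Qed.

(** Once the dimension at s is known, so is the law of the diagonal entry; it has no atom at 0, and
    [cutn_tr] then lowers the trace by exactly one almost surely. *)
Let section_trace s : (s <= q)%N -> nu [set P | \tr (W s P) = (q - s)%:R] = 1%E.
Proof.
have mT s' : measurable [set P | \tr (W s' P) = (q - s')%:R].
  have -> : [set P | \tr (W s' P) = (q - s')%:R] = [set P | \tr (W s' P) - (q - s')%:R = 0].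
    by apply/seteqP; split => x /= => [->|/eqP]; rewrite ?subrr// subr_eq0 => /eqP.
  apply: measurable_eq0; apply: measurable_funB; last exact: measurable_cst.
  exact: measurable_trace.
elim: s => [_|s IH sq].
  apply/eqP; rewrite eq_le probability_le1//= -[leLHS]nu_supp.
  apply: le_measure; rewrite ?inE//.
  by move=> P GP /=; rewrite WG// subn0; have /sidem_orth_proj[_ ->] := GP.
have sn : (s < n)%N by lia.
pose s' := Ordinal sn.
have tr1 := IH (ltnW sq).
have a0 : nu [set P | W s P s' s' = 0] = 0%E.
  have := @alpha_law s' sq tr1 [set 0] (measurable_set1 0).
  (* r^-2 does not vanish for r > 1, so the integral giving the mass of {0} runs over the empty
     set. *)
  rewrite (_ : `]1%R, +oo[ `&` _ = set0) ?integral_set0//.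
  apply/seteqP; split => // r [/=]; rewrite in_itv/= andbT => r1 /eqP.
  by rewrite sqrf_eq0 invr_eq0 => /eqP r0; move: r1; rewrite r0 ltr10.
have m0 : measurable [set P | W s P s' s' = 0] by apply: measurable_eq0; exact: mW.
have E : nu ([set P | \tr (W s P) = (q - s)%:R] `\` ([set P | W s P s' s' = 0] `|` ~` G)) = 1%E.
  rewrite setDE setCU setCK; apply: prob1I => //.
  - by apply: measurableI => //; exact: measurableC.
  - apply: prob1I => //; first exact: measurableC.
    by apply: etrans (probability_setC nu m0) _; rewrite a0 sube0.
apply/eqP; rewrite eq_le probability_le1//= -[leLHS]E.
apply: le_measure; rewrite ?inE//.
  by apply: measurableD => //; apply: measurableU => //; exact: measurableC.
move=> P [/= h1 /not_orP[h2 /contrapT GP]]; move: h1 h2; rewrite !WG//.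
have sP : sidem (P : 'M[R]_n) by have /sidem_orth_proj[] := GP.
move=> h1 h2; rewrite (cutn_tr s' sP) h1.
have -> : (cutn (P : 'M[R]_n) s' s' s' != 0) = true by apply/eqP.
have -> : (q - s = (q - s.+1).+1)%N by lia.
by rewrite -natr1 addrK.
Qed.

Lemma section_law (s : 'I_n) (C : set R) : (s < q)%N -> measurable C ->
  nu [set P | G P /\ C (cutn (P : 'M[R]_n) s s s)] =
  (\int[lebesgue_measure]_(r in `]1%R, +oo[ `&` [set r | C ((r^-1 ^+ 2)%R : R)]) (rdens (q - s) d r)%:E)%E.
Proof.
move=> sq mC; rewrite -(alpha_law sq (section_trace (ltnW sq)) mC).
have mA : measurable [set P | C (W s P s s)].
  have bX : bmeas (fun P => W s P s s) by exact: bmeas_entry.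
  by have := bX.1 measurableT _ mC; rewrite setTI.
apply: (@prob_eq1 _ _ _ nu _ _ G) => //.
- have -> : [set P | G P /\ C (cutn (P : 'M[R]_n) s s s)] = [set P | C (W s P s s)] `&` G.
    by apply/seteqP; split => P /= [h1 h2]; split=> //; [rewrite WG|rewrite -WG].
  exact: measurableI.
- by move=> P GP /=; rewrite WG//; split=> [[]|].
Qed.

End section_law.

(** * Reduction to a fixed tangent flat *)

Section standard_flat.
Variables (R : realType).

Lemma dist_o_rot n (S : set 'rV[R]_n) (U : 'M[R]_n) : U *m U^T = 1%:M ->
  dist_o [set x *m U | x in S] = dist_o S.
Proof.
move=> UU; rewrite /dist_o; congr ereal_inf; apply/seteqP; split => r /=.
  by move=> [_ [x Sx <-] <-]; exists x => //; rewrite enorm_orth.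
by move=> [x Sx <-]; exists (x *m U); [exists x|rewrite enorm_orth].
Qed.

Lemma flats_rot n (P : 'M[R]_n) (p : 'M[R]_n * 'rV[R]_n) (U : 'M[R]_n) : U *m U^T = 1%:M ->
  lin_set (rotG U P) `&` aff_set (rotA U p) = [set x *m U | x in lin_set P `&` aff_set p].
Proof.
move=> UU; have UU' : U^T *m U = 1%:M by exact: mulmx1C.
have K (Q : 'M[R]_n) (y : 'rV[R]_n) : (y *m U) *m (U^T *m Q *m U) = (y *m Q) *m U.
  by rewrite !mulmxA -(mulmxA y) UU mulmx1.
have inj (y z : 'rV[R]_n) : y *m U = z *m U -> y = z.
  by move=> /(congr1 (mulmx^~ U^T)); rewrite -!mulmxA UU !mulmx1.
apply/seteqP; split => [x [/= h1 h2]|_ [x [/= h1 h2] <-]].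
  exists (x *m U^T); last by rewrite -mulmxA UU' mulmx1.
  have xE : x = x *m U^T *m U by rewrite -mulmxA UU' mulmx1.
  move: h1 h2; rewrite /lin_set /aff_set /rotG /rotA /= {1 2 3 4}xE K => /inj h1.
  rewrite -mulmxBl K => /inj h2; by split.
split; rewrite /lin_set /aff_set /rotG /rotA /= ?K ?h1//.
by rewrite -mulmxBl K h2.
Qed.

Lemma dist_flats_rot n (P : 'M[R]_n) (p : 'M[R]_n * 'rV[R]_n) (U : 'M[R]_n) : U *m U^T = 1%:M ->
  dist_o (lin_set (rotG U P) `&` aff_set (rotA U p)) = dist_o (lin_set P `&` aff_set p).
Proof. by move=> UU; rewrite flats_rot// dist_o_rot. Qed.

Variables (s m : nat).
Local Notation n := (s + (1 + m))%N.

(* The flat [e_s + span (e_i, s < i)]. *)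
Definition stdflat : 'M[R]_n * 'rV[R]_n :=
  (block_mx 0 0 0 (block_mx 0 0 0 1%:M), row_mx 0 (row_mx 1%:M 0)).

(** The rows of [U] are an orthonormal frame of the range of [Q], the orthogonal complement of M + R
    u, followed by [u] and by a frame of M. *)
Lemma tangent_flat_frame (p : 'M[R]_n * 'rV[R]_n) : tangent_flat m p ->
  exists U : 'M[R]_n, U *m U^T = 1%:M /\ rotA U stdflat = p.
Proof.
case: p => M u [] /= /sidem_orth_proj[sM tM] [uM u1].
have uu : u *m u^T = 1%:M.
  rewrite sqnE; suff -> : sqn u = 1 by [].
  by move: u1; rewrite /enorm -/(sqn u) => /(congr1 (fun r => r ^+ 2)); rewrite sqr_sqrtr ?sqn_ge0// expr1n.
have [MT MM] := sM.
have Mu : M *m u^T = 0 by apply: trmx_inj; rewrite trmx_mul trmxK MT uM trmx0.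
pose Q : 'M[R]_n := 1%:M - M - u^T *m u.
have sQ : sidem Q.
  split; first by rewrite /Q !linearB/= trmx1 MT trmx_mul trmxK.
  have uuuu : u^T *m u *m (u^T *m u) = u^T *m u.
    by rewrite mulmxA -(mulmxA u^T u) uu mulmx1.
  have Muu : M *m (u^T *m u) = 0 by rewrite mulmxA Mu mul0mx.
  have uuM : u^T *m u *m M = 0 by rewrite -mulmxA uM mulmx0.
  rewrite /Q !mulmxBl !mulmxBr !mul1mx !mulmx1 MM uuuu Muu uuM.
  by apply/matrixP => i j; rewrite !mxE; ring.
have tQ : \tr Q = s%:R.
  rewrite /Q !linearB/= mxtrace1 tM mxtrace_mulC uu mxtrace1 !natrD; ring.
have [F [FF FQ]] := frame_exists sQ tQ.
have [H [HH HM]] := frame_exists sM tM.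
have zeroT k l (A : 'M[R]_(k, n)) (B : 'M[R]_(l, n)) : A *m B^T = 0 -> B *m A^T = 0.
  by move=> h; apply: trmx_inj; rewrite trmx_mul trmxK h trmx0.
have FM : F *m M = 0.
  have FQ' : F *m Q = F by rewrite -FQ mulmxA FF mul1mx.
  have QM : Q *m M = 0.
    by rewrite /Q !mulmxBl mul1mx MM -mulmxA uM mulmx0 subrr subr0.
  by rewrite -FQ' -mulmxA QM mulmx0.
have Fu : F *m u^T = 0.
  have FQ' : F *m Q = F by rewrite -FQ mulmxA FF mul1mx.
  have Qu : Q *m u^T = 0.
    by rewrite /Q !mulmxBl mul1mx Mu subr0 -mulmxA uu mulmx1 subrr.
  by rewrite -FQ' -mulmxA Qu mulmx0.
have HM' : H *m M = H by rewrite -HM mulmxA HH mul1mx.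
have FH : F *m H^T = 0.
  by rewrite -HM' trmx_mul MT mulmxA FM mul0mx.
have uH : u *m H^T = 0 by rewrite -HM' trmx_mul MT mulmxA uM mul0mx.
exists (col_mx F (col_mx u H)); split.
  rewrite !tr_col_mx mul_col_row mul_mx_row mul_col_mx mul_col_row.
  rewrite FF Fu FH uu uH HH (zeroT _ _ _ _ Fu) (zeroT _ _ _ _ FH) (zeroT _ _ _ _ uH).
  by rewrite row_mx0 col_mx0 -!scalar_mx_block.
rewrite /rotA /stdflat /=; congr pair.
  rewrite !tr_col_mx mul_row_block !mulmx0 !add0r mul_row_block !mulmx0 !add0r mulmx1.
  by rewrite !mul_row_col !mul0mx !add0r HM.
by rewrite !mul_row_col !mul0mx add0r addr0 mul1mx.
Qed.

(* Reversing the last coordinate fixes the standard flat. *)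
Lemma tangent_flat_rotation (p : 'M[R]_n * 'rV[R]_n) : (0 < m)%N -> tangent_flat m p ->
  exists U : 'M[R]_n, rotation U /\ rotA U stdflat = p.
Proof.
move=> m0 /tangent_flat_frame[U [UU Up]].
have dU : \det U * \det U = 1.
  by have := congr1 determinant UU; rewrite det_mulmx det_tr det1.
have [d1|d1] := eqVneq (\det U) 1; first by exists U.
have dm : \det U = -1.
  move/eqP: dU; rewrite -expr2 sqrf_eq1 (negbTE d1) => /eqP.
  by [].
pose i0 : 'I_m := Ordinal m0.
pose dg : 'rV[R]_m := \row_j (if j == i0 then -1 else 1).
pose D1 : 'M[R]_m := diag_mx dg.
have D1T : D1^T = D1 by exact: tr_diag_mx.
have D1D : D1 *m D1 = 1%:M.
  apply/matrixP => i j; rewrite mul_diag_mx !mxE.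
  by case: (i == i0); case: (i == j); rewrite /= ?mulr1n ?mulr0n; ring.
pose D : 'M[R]_n := block_mx 1%:M 0 0 (block_mx 1%:M 0 0 D1).
have DT : D^T = D by rewrite /D !tr_block_mx !trmx0 !trmx1 D1T.
have DD : D *m D = 1%:M.
  rewrite /D !mulmx_block !mulmx0 !mul0mx !mulmx1 !addr0 !add0r D1D.
  by rewrite -!scalar_mx_block.
exists (D *m U); split; first split.
- by rewrite trmx_mul DT mulmxA -(mulmxA D U) UU mulmx1.
- rewrite det_mulmx dm /D det_ublock det1 mul1r det_ublock det1 mul1r /D1 det_diag.
  rewrite (bigD1 i0)//= big1 ?mxE ?eqxx; first by rewrite mulr1 mulrNN mulr1.
  by move=> j ji; rewrite mxE (negbTE ji).
- rewrite -Up /rotA /stdflat /=; congr pair.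
    rewrite trmx_mul DT !mulmxA -(mulmxA U^T D) -(mulmxA U^T _ D); congr (_ *m _ *m _).
    by rewrite /D !(mulmx_block, mulmx0, mul0mx, mulmx1, mul1mx, addr0, add0r) D1D.
  rewrite mulmxA; congr (_ *m _).
  by rewrite /D !(mul_row_block, mulmx0, mul0mx, mulmx1, mul1mx, addr0, add0r).
Qed.

End standard_flat.

(** * Distance from the origin to the section by the standard flat *)

Section standard_distance.
Variables (R : realType) (s m : nat).
Local Notation n := (s + (1 + m))%N.

Definition pivot : 'I_n := rshift s (lshift m ord0).

Lemma pivotE : pivot = s :> nat. Proof. by rewrite /= addn0. Qed.

Lemma aff_stdflat (x : 'rV[R]_n) : aff_set (stdflat R s m) x <->
  (forall i : 'I_n, (i < s)%N -> x 0 i = 0) /\ x 0 pivot = 1.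
Proof.
rewrite /aff_set /stdflat /=; split=> [h|[h1 h2]].
  split=> [i is_|].
    have := congr1 (fun y : 'rV_n => y 0 i) h.
    have -> : i = lshift (1 + m) (Ordinal is_) by exact: val_inj.
    rewrite -[x - _]hsubmxK mul_row_block !mulmx0 !addr0 !row_mxEl mxE => /esym.
    by rewrite linearB /= row_mxKl subr0 !mxE.
  have := congr1 (fun y : 'rV_n => y 0 pivot) h; rewrite /pivot.
  rewrite -[x - _]hsubmxK mul_row_block !mulmx0 !add0r !row_mxEr.
  rewrite -[rsubmx _]hsubmxK mul_row_block !mulmx0 !addr0 !row_mxEl mxE => /esym.
  by rewrite !linearB /= row_mxKr row_mxKl !mxE eqxx mulr1n => /eqP; rewrite subr_eq0 => /eqP.
set y := x - _.
have y1 : lsubmx y = 0.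
  by apply/rowP => i; rewrite /y linearB /= row_mxKl subr0 !mxE; apply: h1 => /=.
have y2 : lsubmx (rsubmx y) = 0.
  apply/rowP => i; rewrite /y !linearB /= row_mxKr row_mxKl !mxE !ord1 eqxx mulr1n.
  by rewrite -/pivot h2 subrr.
rewrite -[y]hsubmxK -[rsubmx y]hsubmxK y1 y2.
by rewrite !(mul_row_block, mulmx0, mul0mx, mulmx1, mul1mx, addr0, add0r).
Qed.

(** The equations x_i = 0 for i < s are absorbed in W = [cutn P s], and x_s = 1 is one more cut. Its
    foot point is W_ss^-1 e_s W, of squared norm W_ss^-1; if W_ss = 0, this last equation is
    inconsistent and the section is empty. *)
Lemma dist_stdflat (P : 'M[R]_n) : sidem P ->
  dist_o (lin_set P `&` aff_set (stdflat R s m)) =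
  (if (cutn P s pivot pivot == 0)%R then +oo else (Num.sqrt (cutn P s pivot pivot))^-1%:E)%E.
Proof.
move=> sP; pose W := cutn P s; have sW : sidem W by exact: cutn_sidem.
pose a := ecol R n s; have aE : a = ecol R n pivot by rewrite /a pivotE.
have al : (a^T *m W *m a) 0 0 = W pivot pivot by rewrite aE ecol_quad.
pose y' := cutv W 0 a 1; pose W' := cutP W a.
have E x : (lin_set P `&` aff_set (stdflat R s m)) x <->
    ((x - y') *m W' = x - y' /\ (W pivot pivot = 0 -> (1 : R) = 0)).
  have z0 : ((0 : 'rV[R]_n) *m a) 0 0 = 0 by rewrite mul0mx mxE.
  have := @cutv_flat _ _ W a sW 0 1 x; rewrite z0 !subr0 al => <-.
  rewrite {1}aE mul_ecol mxE /setI /= aff_stdflat /W cutn_fix//.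
  by rewrite /lin_set /=; tauto.
case: eqVneq => [al0|al0].
  rewrite -(dist_set0 R n); congr dist_o; apply/seteqP; split=> // x /E[_ /(_ al0)/eqP].
  by rewrite oner_eq0.
have -> : lin_set P `&` aff_set (stdflat R s m) = [set x | (x - y') *m W' = x - y'].
  apply/seteqP; split=> x; first by move=> /E[].
  by move=> h; apply/E; split=> // /eqP; rewrite (negbTE al0).
rewrite dist_flat; last 2 first.
- by case: (cutP_sidem a sW).
- by apply: cutv_perp => //; rewrite mul0mx.
congr (_%:E); rewrite /enorm -/(sqn _) /y' /cutv mul0mx mxE subr0 add0r al mul1r.
have -> : sqn ((W pivot pivot)^-1 *: (a^T *m W)) = (W pivot pivot)^-1.
  have -> : sqn ((W pivot pivot)^-1 *: (a^T *m W)) = (W pivot pivot)^-1 ^+ 2 * sqn (a^T *m W).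
    by rewrite /sqn mulr_sumr; apply: eq_bigr => j _; rewrite mxE exprMn.
  by rewrite -(sidem_quad a sW) al expr2 -mulrA mulVf// mulr1.
by rewrite sqrtrV// -al sidem_quad// sqn_ge0.
Qed.

End standard_distance.

(** Uniqueness on rectangles gives the order of integration in which the flat is frozen and the
    subspace varies. *)
Lemma product_measure_swap d1 d2 (T1 : measurableType d1) (T2 : measurableType d2) (R : realType)
  (P1 : probability T1 R) (P2 : probability T2 R) (A : set (T1 * T2)) : measurable A ->
  (P1 \x P2)%E A = (\int[P2]_y P1 (ysection A y))%E.
Proof.
move=> mA.
have := @product_measure_unique _ _ T1 T2 R P1 P2 (P1 \x^ P2)%E.
move=> -> //.
by move=> B C mB mC; exact: product_measure2E.
Qed.

Section standard_law.
Variables (R : realType) (s m q : nat).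
Local Notation n := (s + (1 + m))%N.
Hypotheses (sq : (s < q)%N) (qn : (q <= n - 1)%N) (m0 : (0 < m)%N).
Variables (nu : probability (GrT R n) R) (sigma : probability (AffT R n) R).
Hypothesis nu_supp : nu [set P | is_orth_proj q P] = 1%E.
Hypothesis nu_inv : forall U : 'M[R]_n, rotation U ->
     forall A : set (GrT R n), measurable A -> nu (rotG U @^-1` A) = nu A.
Hypothesis sigma_supp : sigma [set p | tangent_flat m p] = 1%E.

Lemma distance_law (B : set R) : measurable B ->
  (nu \x sigma)%E
      [set LE : GrT R n * AffT R n |
         (EFin @` B) (dist_o (lin_set LE.1 `&` aff_set LE.2))]
  = (\int[lebesgue_measure]_(r in B `&` `]1%R, +oo[) (rdens (q - s) (n - q) r : R)%:E)%E.
Proof.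
move=> mB; set A := [set LE | _].
have n0 : (0 < n)%N by lia.
have mA : measurable A by exact: measurable_dist_event.
pose E p : set (GrT R n) := [set P | (EFin @` B) (dist_o (lin_set (P : 'M[R]_n) `&` aff_set (p : 'M[R]_n * 'rV[R]_n)))].
have EA p : ysection A p = E p.
  by apply/seteqP; split=> P; rewrite /ysection /= ?inE.
have mE p : measurable (E p) by rewrite -EA; exact: measurable_ysection.
have Econst p : tangent_flat m p -> nu (E p) = nu (E (stdflat R s m)).
  move=> /(tangent_flat_rotation m0)[U [rU Up]].
  have key P : dist_o (lin_set (rotG U P) `&` aff_set p) =
      dist_o (lin_set P `&` aff_set (stdflat R s m)).
    by rewrite -Up dist_flats_rot//; case: rU.
  by rewrite -(nu_inv rU (mE p)); congr (nu _); apply/seteqP; split=> P; rewrite /E /= key.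
transitivity (nu (E (stdflat R s m))).
  rewrite product_measure_swap//.
  transitivity (\int[sigma]_p cst (nu (E (stdflat R s m))) p)%E.
    apply: ae_eq_integral => //.
    - exact: measurable_fun_ysection.
    - have mT := @measurable_tangent_flat R n m n0.
      exists (~` [set p | tangent_flat m p]); split; first exact: measurableC.
        by apply: etrans (probability_setC sigma mT) _; rewrite sigma_supp subee.
      by move=> p /= h tp; apply: h => _; rewrite EA Econst.
  rewrite integral_cst//; transitivity (nu (E (stdflat R s m)) * 1)%E; last by rewrite mule1.
  by congr (_ * _)%E; exact: probability_setT.
(* C is the set of values a for which a^(-1/2) lies in [B]. The value 0 is excluded because it means
   an empty section, while the convention 0^-1 = 0 would otherwise accept it whenever 0 is in
   [B]. *)
pose C : set R := [set x | x <> 0 /\ B (Num.sqrt x)^-1].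
have mC : measurable C.
  have -> : C = ~` [set 0] `&` (fun x : R => (Num.sqrt x)^-1) @^-1` B.
    by apply/seteqP; split=> x.
  apply: measurableI; first by apply: measurableC; exact: measurable_set1.
  rewrite -[X in measurable X]setTI.
  have := @measurable_fun_inv _ _ R (@Num.sqrt R) (continuous_measurable_fun (@sqrt_continuous R)).
  by move=> /(_ measurableT _ mB).
have q1 : (1 <= q)%N by apply: leq_ltn_trans sq.
have law := section_law q1 qn nu_supp nu_inv (s := pivot s m) (C := C).
rewrite pivotE in law; move: (law sq mC) => {}law.
transitivity (nu [set P | is_orth_proj q P /\ C (cutn (P : 'M[R]_n) s (pivot s m) (pivot s m))]).
  apply: (@prob_eq1 _ _ _ nu _ _ [set P | is_orth_proj q P]) => //.
  - have -> : [set P : GrT R n | is_orth_proj q P /\ C (cutn (P : 'M[R]_n) s (pivot s m) (pivot s m))] =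
       [set P : GrT R n | is_orth_proj q P] `&` [set P : GrT R n | C (cutn (P : 'M[R]_n) s (pivot s m) (pivot s m))] by [].
    apply: measurableI; first exact: (measurable_orth_proj q (@mxmeas_GrT R n)).
    have mcp : measurable_fun [set: GrT R n] (fun P : GrT R n => cutn (P : 'M[R]_n) s (pivot s m) (pivot s m)).
      exact: mxmeas_cutn.
    by have := mcp measurableT _ mC; rewrite setTI.
  - exact: (measurable_orth_proj q (@mxmeas_GrT R n)).
  - move=> P GP; have sP : sidem (P : 'M[R]_n) by have /sidem_orth_proj[] := GP.
    rewrite /E /= dist_stdflat//.
    case: eqVneq => h; first by split=> [[x _]//|[_ []]]; rewrite h.
    split=> [[x Bx [xE]]|[_ [_ Bx]]]; last by exists (Num.sqrt (cutn (P : 'M[R]_n) s (pivot s m) (pivot s m)))^-1.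
    by split=> //; split; [exact/eqP|rewrite -xE].
rewrite law; congr (integral _ _ _); rewrite setIC.
apply/seteqP; split=> r /=; rewrite in_itv/= andbT.
  move=> [[_ Br] r1]; split=> //; move: Br.
  have r0 : 0 < r by apply: lt_trans r1.
  by rewrite sqrtr_sqr gtr0_norm ?invr_gt0// invrK.
move=> [Br r1]; split=> //; have r0 : 0 < r by apply: lt_trans r1.
split; first by apply/eqP; rewrite sqrf_eq0 invr_eq0 gt_eqF.
by rewrite sqrtr_sqr gtr0_norm ?invr_gt0// invrK.
Qed.

End standard_law.

Unset Implicit Arguments.

Theorem theorem6p2 (R : realType) (n q g : nat)
  (hn : (2 <= n)%N) (hq1 : (1 <= q)%N) (hq2 : (q <= n - 1)%N)
  (hg : (g <= q - 1)%N)
  (nu : probability (GrT R n) R) (sigma : probability (AffT R n) R)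
  (nu_supp : nu [set P | is_orth_proj q P] = 1%E)
  (nu_inv : forall U : 'M[R]_n, rotation U ->
     forall A : set (GrT R n), measurable A -> nu (rotG U @^-1` A) = nu A)
  (sigma_supp : sigma [set p | tangent_flat (n - q + g)%N p] = 1%E)
  (sigma_inv : forall U : 'M[R]_n, rotation U ->
     forall A : set (AffT R n), measurable A ->
       sigma (rotA U @^-1` A) = sigma A) :
  forall B : set R, measurable B ->
    (nu \x sigma)%E
      [set LE : GrT R n * AffT R n |
         (EFin @` B) (dist_o (lin_set LE.1 `&` aff_set LE.2))]
    = (\int[lebesgue_measure]_(x in B) (gdens n q g x)%:E)%E.
Proof.
move=> B mB.
(* s is the codimension of M + R u, since n - 1 - (n - q + g) = q - g - 1, and q - s = g + 1 is the
   dimension of its section with L. Substituting for [q] and [n] gives the ambient dimension the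
   block shape of the standard flat, with m = d + g. *)
pose s := (q - g - 1)%N; pose d := (n - q)%N.
have Eq : q = (s + g.+1)%N by rewrite /s; lia.
have En : n = (s + (1 + (d + g)))%N by rewrite /s /d; lia.
have d0 : (0 < d)%N by rewrite /d; lia.
clearbody s d; subst q; subst n.
have e1 : (s + (1 + (d + g)) - (s + g.+1) = d)%N by lia.
have e2 : (s + (1 + (d + g)) - (s + g.+1 - g) + 1 = g.+1 + d)%N by lia.
rewrite e1 in sigma_supp.
have sq : (s < s + g.+1)%N by lia.
have m0 : (0 < d + g)%N by lia.
rewrite (distance_law sq hq2 m0 nu_supp nu_inv sigma_supp mB).
rewrite e1 addKn integral_mkcondr; apply: eq_integral => r _.
rewrite patchE /gdens e1 e2; case: ifPn => h.
  have /= : `]1%R, +oo[%classic r by exact: set_mem.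
  rewrite in_itv/= andbT => ->.
  by rewrite /rdens /phi !exprVn mulrA addn2.
have : ~ `]1%R, +oo[%classic r by move/mem_set; rewrite (negbTE h).
by rewrite /= in_itv/= andbT => /negP/negbTE ->.
Qed.
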